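(* Let $X$ be a non-degenerate affine toric variety over $\mathbb{K}$. Suppose that $x_1,\ldots,x_s$ and $x_1',\ldots,x_s'$ are points on $X$ with $x_i\ne x_j$ and $x_i'\ne x_j'$ for $i\ne j$ such that for each $i$ the orbits $\mathcal{A}(X)\cdot x_i$ and $\mathcal{A}(X)\cdot x_i'$ are equal and of dimension $\ge 2$. Then there exists an element $\phi\in\mathcal{A}(X)$ such that $\phi(x_i)=x_i'$ for $i=1,\ldots,s$. Here $\mathcal{A}(X)$ denotes the subgroup of $\mathrm{Aut}(X)$ generated by all root subgroups $H_e$, $e\in\mathcal{R}$, and all their replicas.
   Context: The ground field $\mathbb{K}$ is algebraically closed of characteristic zero. A toric variety is a normal algebraic variety $X$ containing an algebraic torus $T$ as a dense open subset such that the action of $T$ on itself extends to a regular action of $T$ on $X$. Let $N$ be the lattice of one-parameter subgroups of $T$, $M=\mathrm{Hom}(N,\mathbb{Z})$ the lattice of characters of $T$ (the character corresponding to $m\in M$ is written $\chi^m$), and $\langle\cdot,\cdot\rangle:N\times M\to\mathbb{Z}$ the pairing. Every affine toric variety is of the form $X=X_\sigma=\mathrm{Spec}\,\mathbb{K}[\sigma^\vee\cap M]$ for a (strongly convex) rational polyhedral cone $\sigma\subset N_{\mathbb{Q}}=N\otimes_{\mathbb Z}\mathbb{Q}$ with dual cone $\sigma^\vee\subset M_{\mathbb{Q}}$. $X$ is non-degenerate if every invertible regular function on $X$ is constant (equivalently, $\sigma$ spans $N_{\mathbb{Q}}$). Let $\sigma(1)$ be the set of rays of $\sigma$ and $v_\tau$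 the primitive lattice vector on a ray $\tau$. A Demazure root of $\sigma$ is an element $e\in M$ for which there is $\tau\in\sigma(1)$ with $\langle v_\tau,e\rangle=-1$ and $\langle v_{\tau'},e\rangle\ge 0$ for all $\tau'\in\sigma(1)\setminus\{\tau\}$; write $v_e:=v_\tau$ for this ray. $\mathcal{R}=\mathcal{R}(\sigma)$ is the set of all Demazure roots. A derivation $\partial$ of $A=\mathbb{K}[X]$ is locally nilpotent if for every $a\in A$ there is $n$ with $\partial^n(a)=0$; it defines a one-parameter unipotent subgroup $H(\partial)=\exp(\mathbb{K}\partial)\subseteq\mathrm{Aut}(X)$. For $f\in\mathrm{Ker}\,\partial$ the derivation $f\partial$ is again locally nilpotent, and the subgroups $H(f\partial)$, $f\in\mathrm{Ker}\,\partial$, are called the replicas of $H(\partial)$. For $e\in\mathcal{R}$ the root subgroup $H_e\cong(\mathbb{K},+)$ is $H_e=H(\partial_e)$, where $\partial_e$ is the locally nilpotent derivation $\partial_e(\chi^m)=\langle v_e,m\rangle\chi^{m+e}$ for $m\in\sigma^\vee\cap M$. It is normalized by $T$, and every one-parameter unipotent subgroup of $\mathrm{Aut}(X)$ normalized by $T$ is of this form. *)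

(* Defs.v *)
From HB Require Import structures.
From mathcomp Require Import all_boot all_order all_algebra finmap.
From mathcomp Require Import monalg.
From mathcomp Require Import boolp classical_sets.

Set Implicit Arguments.
Unset Strict Implicit.
Unset Printing Implicit Defensive.

Import GRing.Theory Num.Theory.
Local Open Scope classical_set_scope.
Local Open Scope ring_scope.

(* The type [{malg K[S]}] of finitely supported functions carries a product
   in the library only for multiplicative monoids without non-trivial units;
   here [S] is an arbitrary additive commutative monoid.  [<< c *g s >>] is
   the term $c \chi^s$. *)
Definition semigroup_algebra (K : comNzRingType) (S : nmodType) : Type :=
  {malg K[S]}.

Section SemigroupAlgebra.
Variables (K : comNzRingType) (S : nmodType).
Local Notation A := (semigroup_algebra K S).
Implicit Types (f g h : A) (s t : S) (c : K).

HB.instance Definition _ := GRing.Lmodule.on A.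

Definition sgmul f g : A :=
  \sum_(s <- msupp f) \sum_(t <- msupp g) << f@_s * g@_t *g s + t >>.

Definition sgone : A := << (1 : K) *g (0 : S) >>.

Lemma sgmulw (d1 d2 : {fset S}) f g :
  (msupp f `<=` d1)%fset -> (msupp g `<=` d2)%fset ->
  sgmul f g = \sum_(s <- d1) \sum_(t <- d2) << f@_s * g@_t *g s + t >>.
Proof.
move=> le1 le2; rewrite /sgmul (big_fset_incl _ le1) /=.
  apply: eq_bigr => s _; apply: (big_fset_incl _ le2) => t _ /mcoeff_outdom ->.
  by rewrite mulr0 monalgU0.
move=> s _ /mcoeff_outdom ->.
by rewrite big1 // => t _; rewrite mul0r monalgU0.
Qed.

Lemma sgmulUU c1 c2 s t :
  sgmul << c1 *g s >> << c2 *g t >> = << c1 * c2 *g s + t >>.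
Proof.
by rewrite (sgmulw msuppU_le msuppU_le) !big_seq_fset1 !mcoeffUU.
Qed.

Lemma sgmulC : commutative sgmul.
Proof.
move=> f g; rewrite /sgmul exchange_big /=.
by apply: eq_bigr => s _; apply: eq_bigr => t _; rewrite mulrC addrC.
Qed.

Lemma sgmulDl : left_distributive sgmul +%R.
Proof.
move=> f g h.
have lef : (msupp f `<=` msupp f `|` msupp g)%fset by exact: fsubsetUl.
have leg : (msupp g `<=` msupp f `|` msupp g)%fset by exact: fsubsetUr.
rewrite (sgmulw (msuppD_le f g) (fsubset_refl (msupp h))).
rewrite (sgmulw lef (fsubset_refl (msupp h))).
rewrite (sgmulw leg (fsubset_refl (msupp h))).
rewrite -big_split /=; apply: eq_bigr => s _.
rewrite -big_split /=; apply: eq_bigr => t _.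
by rewrite mcoeffD mulrDl monalgUD.
Qed.

Lemma sgmulDr : right_distributive sgmul +%R.
Proof. by move=> f g h; rewrite !(sgmulC f) sgmulDl. Qed.

Lemma sgmul0g : left_zero 0 sgmul.
Proof. by move=> f; rewrite /sgmul msupp0 big_seq_fset0. Qed.

Lemma sgmul_suml (I : Type) (r : seq I) (F : I -> A) g :
  sgmul (\sum_(i <- r) F i) g = \sum_(i <- r) sgmul (F i) g.
Proof.
by apply: (big_morph (sgmul^~ g)) => [x y|]; rewrite ?sgmulDl ?sgmul0g.
Qed.

Lemma sgmul_sumr (I : Type) (r : seq I) (F : I -> A) g :
  sgmul g (\sum_(i <- r) F i) = \sum_(i <- r) sgmul g (F i).
Proof.
by rewrite sgmulC sgmul_suml; under eq_bigr do rewrite sgmulC.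
Qed.

Lemma sgE f : f = \sum_(s <- msupp f) << f@_s *g s >> :> A.
Proof. exact: monalgE. Qed.

Lemma sgmul1g : left_id sgone sgmul.
Proof.
move=> f; rewrite [f in LHS]sgE sgmul_sumr [RHS]sgE.
by apply: eq_bigr => s _; rewrite sgmulUU mul1r add0r.
Qed.

Lemma sgmulEl f g : sgmul f g = \sum_(s <- msupp f) sgmul << f@_s *g s >> g.
Proof. by rewrite -sgmul_suml -sgE. Qed.

Lemma sgmulEr f g : sgmul f g = \sum_(t <- msupp g) sgmul f << g@_t *g t >>.
Proof. by rewrite -sgmul_sumr -sgE. Qed.

Lemma sgmulA : associative sgmul.
Proof.
move=> f g h.
rewrite (sgmulEl f (sgmul g h)) (sgmulEl f g) (sgmul_suml _ _ h).
apply: eq_bigr => s _.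
rewrite (sgmulEl g h) (sgmulEr _ g).
rewrite (sgmul_suml _ _ h) (sgmul_sumr _ _ << _ *g s >>).
apply: eq_bigr => t _.
rewrite (sgmulEr _ h) (sgmul_sumr _ _ << _ *g s >>) [RHS]sgmulEr.
by apply: eq_bigr => u _; rewrite !sgmulUU mulrA addrA.
Qed.

Lemma sgone_neq0 : sgone != 0.
Proof. by rewrite /sgone monalgU_eq0 oner_neq0. Qed.

HB.instance Definition _ := GRing.Zmodule_isComNzRing.Build A
  sgmulA sgmulC sgmul1g sgmulDl sgone_neq0.

Lemma sgscaleAl c f g : c *: (f * g) = (c *: f) * g.
Proof.
rewrite /GRing.mul /= (sgmulw (msuppZ_le c f) (fsubset_refl (msupp g))).
rewrite /sgmul scaler_sumr; apply: eq_bigr => s _.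
rewrite scaler_sumr; apply: eq_bigr => t _.
apply/malgP => u; rewrite mcoeffZ !mcoeffU mcoeffZ.
by case: eqP => _; rewrite ?mulr1n ?mulr0n ?mulr0 // mulrA.
Qed.

HB.instance Definition _ := GRing.Lmodule_isLalgebra.Build K A sgscaleAl.
HB.instance Definition _ := GRing.Lalgebra_isComAlgebra.Build K A.

End SemigroupAlgebra.

(* An affine variety $X$ is given by its coordinate algebra [A]: points are
   $\mathbb{K}$-algebra morphisms $A \to \mathbb{K}$ ($f \mapsto f(x)$), and an
   automorphism of $X$ is represented by its comorphism $A \to A$. *)

Section AffineVariety.
Variables (K : fieldType) (A : comAlgType K).

Definition kpoint : Type := {lrmorphism A -> K^o}.

Lemma kpointP (x y : kpoint) : x =1 y <-> x = y.
Proof.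
split=> [/funext|-> //].
case: x y => x cx [y cy] /= E; subst y; congr GRing.LRMorphism.Pack.
case: cx cy => [[a1] [a2] [a3]] [[b1] [b2] [b3]].
by rewrite (Prop_irrelevance a1 b1) (Prop_irrelevance a2 b2)
  (Prop_irrelevance a3 b3).
Qed.

Definition zariski_closed (Z : set kpoint) : Prop :=
  exists I : set A, Z = [set x : kpoint | forall f, I f -> x f = 0].

Definition closed_in (Y Z : set kpoint) : Prop :=
  exists2 C : set kpoint, zariski_closed C & Z = Y `&` C.

Definition irreducible (Z : set kpoint) : Prop :=
  Z !=set0 /\
  forall C1 C2 : set kpoint, zariski_closed C1 -> zariski_closed C2 ->
    Z `<=` C1 `|` C2 -> Z `<=` C1 \/ Z `<=` C2.

(* $\dim Y \ge d$ for the Krull dimension of [Y] with the topology induced by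
   the Zariski topology.  Orbits of algebraically generated groups are locally
   closed, so for them this is the dimension as algebraic varieties. *)
Definition dim_ge (Y : set kpoint) (d : nat) : Prop :=
  exists Z : nat -> set kpoint,
    (forall i, (i <= d)%N -> irreducible (Z i) /\ closed_in Y (Z i)) /\
    (forall i, (i < d)%N -> Z i `<` Z i.+1).

Definition nondegenerate_variety : Prop :=
  forall f g : A, f * g = 1 -> exists c : K, f = c%:A.

(* The automorphism of $X$ with comorphism [phi], applied to the point [x]. *)
Definition aut_act (phi : {lrmorphism A -> A}) (x : kpoint) : kpoint := x \o phi.

Definition orbit_of (G : set {lrmorphism A -> A}) (x : kpoint) : set kpoint :=
  [set y | exists2 phi, G phi & y = aut_act phi x].

(* [G] is meant to consist of automorphisms, as is the case for the
   exponentials below: $\exp(-D)$ is inverse to $\exp(D)$. *)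
Inductive generated_group (G : set {lrmorphism A -> A}) :
    set {lrmorphism A -> A} :=
| gen_mem phi : G phi -> generated_group G phi
| gen_id : generated_group G idfun
| gen_comp (phi psi : {lrmorphism A -> A}) :
    generated_group G phi -> generated_group G psi ->
    generated_group G (phi \o psi)
| gen_inv (phi psi : {lrmorphism A -> A}) :
    generated_group G phi -> cancel phi psi -> cancel psi phi ->
    generated_group G psi.

(* $\exp(D)(a) = \sum_k D^k(a)/k!$ for a locally nilpotent derivation [D],
   cut at some [N] such that $D^N(a) = 0$; the choice of [N] is irrelevant. *)
Definition exp_lnd (D : A -> A) (a : A) : A :=
  \sum_(k < xget 0%N [set N | iter N D a = 0]) (k`!%:R)^-1 *: iter k D a.

Definition unipotent (D : A -> A) : set {lrmorphism A -> A} :=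
  [set phi : {lrmorphism A -> A} |
     exists t : K, phi =1 exp_lnd (fun a => t *: D a)].

Definition replicas (D : A -> A) : set {lrmorphism A -> A} :=
  [set phi : {lrmorphism A -> A} |
     exists2 f : A, D f = 0 & unipotent (fun a => f * D a) phi].

End AffineVariety.

(* $N = \mathbb{Z}^n$ consists of rows and $M = \mathrm{Hom}(N, \mathbb{Z})$ of
   columns, and $\langle v, m \rangle$ is their matrix product. *)
Definition pairing (R : pzRingType) (n : nat) (v : 'rV[R]_n) (m : 'cV[R]_n) : R :=
  (v *m m) 0 0.

Section Cones.
Variable n : nat.
Implicit Types (sigma tau : set 'rV[rat]_n) (v w : 'rV[int]_n) (e : 'cV[int]_n).

Definition rational_polyhedral sigma : Prop :=
  exists (k : nat) (g : 'I_k -> 'rV[int]_n),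
    sigma = [set u | exists2 c : 'I_k -> rat, (forall i, 0 <= c i) &
                       u = \sum_(i < k) c i *: map_mx intr (g i)].

Definition strongly_convex sigma : Prop :=
  forall u, sigma u -> sigma (- u) -> u = 0.

Definition dual_cone sigma : set 'cV[rat]_n :=
  [set m | forall u, sigma u -> 0 <= pairing u m].

Definition face sigma tau : Prop :=
  exists2 m, dual_cone sigma m & tau = sigma `&` [set u | pairing u m = 0].

(* [ray sigma tau] means $\tau \in \sigma(1)$: a face whose span is a line. *)
Definition ray sigma tau : Prop :=
  face sigma tau /\
  exists u, [/\ tau u, u != 0 &
    forall w : 'rV[rat]_n, tau w -> exists c : rat, w = c *: u].

Definition primitive v : Prop :=
  forall (k : int) w, v = k *: w -> `|k| = 1.

(* [primitive_on tau v] means $v = v_\tau$. *)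
Definition primitive_on tau v : Prop := primitive v /\ tau (map_mx intr v).

(* [e] is a Demazure root of [sigma] with $v_e = v$. *)
Definition demazure_root sigma e v : Prop :=
  exists tau, [/\ ray sigma tau, primitive_on tau v, pairing v e = -1 &
    forall tau' v', ray sigma tau' -> tau' <> tau -> primitive_on tau' v' ->
      0 <= pairing v' e].

Definition dual_lattice sigma : {pred 'cV[int]_n} :=
  fun m => `[< dual_cone sigma (map_mx intr m) >].

Lemma dual_lattice_addr_closed sigma : addr_closed (dual_lattice sigma).
Proof.
split=> [|m1 m2 /asboolP h1 /asboolP h2]; apply/asboolP => u su.
  by rewrite /pairing map_mx0 mulmx0 mxE.
by rewrite /pairing map_mxD mulmxDr mxE addr_ge0 ?h1 ?h2.
Qed.

HB.instance Definition _ sigma :=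
  GRing.isAddClosed.Build _ (dual_lattice sigma) (dual_lattice_addr_closed sigma).

Record weight sigma := Weight {
  weight_val :> 'cV[int]_n;
  weightP : weight_val \in dual_lattice sigma }.

HB.instance Definition _ sigma := [isSub for @weight_val sigma].
HB.instance Definition _ sigma := [Choice of weight sigma by <:].
HB.instance Definition _ sigma :=
  GRing.SubChoice_isSubNmodule.Build _ _ (weight sigma)
    (dual_lattice_addr_closed sigma).

End Cones.

Notation toric_algebra K sigma := (semigroup_algebra K (weight sigma)).

Section Toric.
Variables (K : fieldType) (n : nat) (sigma : set 'rV[rat]_n).

Local Notation A := (semigroup_algebra K (weight sigma)).

(* $\chi^m$ for a weight $m \in \sigma^\vee$, and $0$ otherwise. *)
Definition chi (m : 'cV[int]_n) : A :=
  if insub m is Some w then << (1 : K) *g (w : weight sigma) >> else 0.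

(* $\chi^m \mapsto \langle v, m \rangle \chi^{m + e}$; if $v = v_e$ for a
   Demazure root $e$ then $m + e \in \sigma^\vee$ unless
   $\langle v, m \rangle = 0$. *)
Definition root_derivation (e : 'cV[int]_n) (v : 'rV[int]_n) (f : A) : A :=
  \sum_(m <- msupp f)
    (f@_m * (pairing v (\val m : 'cV[int]_n))%:~R) *: chi (\val m + e).

Lemma chiE (w : weight sigma) : chi (\val w) = << (1 : K) *g w >>.
Proof. by rewrite /chi valK. Qed.

Lemma chiD (m1 m2 : 'cV[int]_n) :
  m1 \in dual_lattice sigma -> m2 \in dual_lattice sigma ->
  chi (m1 + m2) = chi m1 * chi m2.
Proof.
move=> h1 h2; rewrite -[m1](SubK (weight sigma) h1) -[m2](SubK (weight sigma) h2).
by rewrite -raddfD !chiE /= [RHS]sgmulUU mulr1.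
Qed.

Lemma root_derivation_chi (e : 'cV[int]_n) (v : 'rV[int]_n) (m : 'cV[int]_n) :
  m \in dual_lattice sigma ->
  root_derivation e v (chi m) = (pairing v m)%:~R *: chi (m + e).
Proof.
move=> hm; rewrite -[m](SubK (weight sigma) hm) chiE /root_derivation msuppU.
by rewrite oner_eq0 big_seq_fset1 mcoeffUU mul1r.
Qed.

Definition root_subgroups_and_replicas : set {lrmorphism A -> A} :=
  [set phi : {lrmorphism A -> A} | exists e v, demazure_root sigma e v /\
     (unipotent (root_derivation e v) phi \/ replicas (root_derivation e v) phi)].

(* $\mathcal{A}(X)$; as comorphisms compose in the opposite order, it is
   represented by its opposite group, which has the same orbits. *)
Definition replica_group : set {lrmorphism A -> A} :=
  generated_group root_subgroups_and_replicas.

End Toric.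

Arguments replica_group K {n} sigma _.

(* Main.v *)
From HB Require Import structures.
Require Import Defs.
From mathcomp Require Import all_boot all_order all_algebra finmap.
From mathcomp Require Import monalg.
From mathcomp Require Import boolp classical_sets.
From mathcomp Require Import zify.

Set Implicit Arguments.
Unset Strict Implicit.
Unset Printing Implicit Defensive.

Import Order.TTheory GRing.Theory Num.Theory.
Local Open Scope classical_set_scope.
Local Open Scope ring_scope.

(* A point [x] of $X$ is a multiplicative map on the weight monoid, and
   $\exp(f\partial_e)$ multiplies $\chi^m(x)$ by
   $(1 + f(x)\chi^e(x))^{\langle v_e, m\rangle}$ when $\chi^e(x)$ makes sense
   and is nonzero ([active]); so on points of maximal support ([generic]) in an
   orbit, a root subgroup moves along the one-parameter subgroup $v_e$ of the
   torus, and two such points of one orbit differ by a product of elements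
   $v_e(\lambda)$, $e$ active.  A replica moves [x] by $v_e(\lambda)$, for any
   given $\lambda \neq 0$, and fixes given points $y_j$ as soon as monomials
   $\chi^w$ with $\langle v_e, w\rangle = 0$ separate [x] from each $y_j$.  If
   the orbit of [x] has dimension at least 2, this separation holds after a
   general translation by the group: a second active root, transverse to the
   first, would otherwise force $x = y_j$.  As the group is irreducible, finitely
   many general position requirements can be met at once.  Finally the points are
   moved to their targets one after the other, fixing the targets already
   reached. *)

(** The torus is not among the generators of the group, so the translation between two generic
    points of an orbit has to be reconstructed: the ratio of two monomials whose difference is
    orthogonal to all active $v_e$ is invariant, and divisibility of $\mathbb{K}^*$ turns this into
    a product of factors $v_e(\lambda)$. The obstacle in fixing the $y_j$ is that intermediate
    points of the resulting path may fail to be separated from them. Each factor therefore gets a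
    free parameter: the two ends are moved by $v_e(u)$ and $v_e(u/\lambda)$, which cancels the
    factor, and all but finitely many $u$ keep both ends separated for the remaining factors. No
    algebraic structure is put on the group. General position is expressed by functions that are
    polynomial along every curve $t \mapsto a \exp(tf\partial_e) b$. *)

Lemma lrmorphismP (K : fieldType) (A : comAlgType K) (phi psi : {lrmorphism A -> A}) :
  phi =1 psi -> phi = psi.
Proof.
case: phi psi => phi cphi [psi cpsi] /= /funext E; subst psi.
congr GRing.LRMorphism.Pack.
case: cphi cpsi => [[a1] [a2] [a3]] [[b1] [b2] [b3]].
by rewrite (Prop_irrelevance a1 b1) (Prop_irrelevance a2 b2)
  (Prop_irrelevance a3 b3).
Qed.

(** * Exponentials of locally nilpotent derivations *)

Section LocallyNilpotent.
Variables (K : fieldType) (A : comAlgType K).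
Hypothesis charK : [pchar K] =i pred0.
Implicit Types (D : A -> A) (a b f : A).

Definition lnd D : Prop :=
  [/\ linear D, forall a b, D (a * b) = D a * b + a * D b &
      forall a, exists N, iter N D a = 0].

Lemma lnd_linear D : lnd D -> exists L : {linear A -> A}, D = L.
Proof.
case=> linD _ _.
pose L : {linear A -> A} := HB.pack D (GRing.isLinear.Build K A A *:%R D linD).
by exists L.
Qed.

Lemma lndM D : lnd D -> forall a b, D (a * b) = D a * b + a * D b.
Proof. by case. Qed.

Lemma lnd_nilp D : lnd D -> forall a, exists N, iter N D a = 0.
Proof. by case. Qed.

Lemma natr_neq0 k : (0 < k)%N -> (k%:R : K) != 0.
Proof. by rewrite (proj1 (pcharf0P K) charK) -lt0n. Qed.

(** In characteristic zero the natural numbers are distinct in [K], and [size p] of them are too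
    many to be roots of [p]. *)
Lemma poly_nonroot (p : {poly K}) : p != 0 -> exists t, p.[t] != 0.
Proof.
move=> p0; apply: contrapT => h.
have /(max_poly_roots p0) : all (root p) [seq i%:R | i <- iota 0 (size p)].
  apply/allP => _ /mapP[i _ ->]; rewrite rootE; apply/negPn/negP => hi; apply: h.
  by exists i%:R.
rewrite size_map size_iota ltnn => H; suff : false by []; apply: H.
rewrite map_inj_uniq ?iota_uniq // => i j /eqP.
wlog le_ij : i j / (i <= j)%N => [h2|].
  by case: (leqP i j) => [/h2//|/ltnW/h2 h3]; rewrite eq_sym => /h3->.
rewrite -(subnKC le_ij) natrD eq_sym -subr_eq0 addrC addKr.
by rewrite (proj1 (pcharf0P K) charK) => /eqP->; rewrite addn0.
Qed.

Lemma poly_eq0_generic (p q : {poly K}) : q != 0 ->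
  (forall t, q.[t] != 0 -> p.[t] = 0) -> p = 0.
Proof.
move=> q0 h; apply/eqP/negPn/negP => p0.
have [t] := poly_nonroot (mulf_neq0 p0 q0).
rewrite hornerM mulf_eq0 negb_or => /andP[pt qt].
by rewrite h ?eqxx in pt.
Qed.

Definition divpow D k a : A := (k`!%:R)^-1 *: iter k D a.

Lemma divpow0 D a : divpow D 0 a = a.
Proof. by rewrite /divpow /= invr1 scale1r. Qed.

Lemma divpowS D k a : lnd D -> D (divpow D k a) = k.+1%:R *: divpow D k.+1 a.
Proof.
move=> /lnd_linear[L ->].
rewrite /divpow linearZ scalerA /= factS natrM invfM mulrA divff ?mul1r //.
by rewrite natr_neq0.
Qed.

Lemma iter0_le D N k a : lnd D -> iter N D a = 0 -> (N <= k)%N -> iter k D a = 0.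
Proof.
move=> /lnd_linear[L ->] h /subnK <-; rewrite iterD h.
by elim: (k - N)%N => //= i ->; rewrite linear0.
Qed.

Lemma divpow_le D N k a : lnd D -> iter N D a = 0 -> (N <= k)%N -> divpow D k a = 0.
Proof. by move=> hD h le; rewrite /divpow (iter0_le hD h le) scaler0. Qed.

(** Divided powers turn the Leibniz rule into a Cauchy product, which makes [taylor] multiplicative.
    The induction compares both sides after multiplication by $n+1$, invertible in characteristic
    zero; the weights $i$ and $n+1-i$ produced by [D] add up to it. *)
Lemma divpowM D n a b : lnd D ->
  divpow D n (a * b) = \sum_(i < n.+1) divpow D i a * divpow D (n - i) b.
Proof.
move=> hD; have [L DL] := lnd_linear hD; elim: n => [|n IHn].
  by rewrite big_ord1 !divpow0.
apply: (@scalerI _ _ (n.+1%:R : K)); first by rewrite natr_neq0.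
rewrite -divpowS // IHn DL linear_sum -DL /=.
under eq_bigr => i _ do
  rewrite (lndM hD) !divpowS // -(scalerAl i.+1%:R) -(scalerAr (n - i).+1%:R).
rewrite big_split /= [RHS]scaler_sumr.
have -> : \sum_(i < n.+1) i.+1%:R *: (divpow D i.+1 a * divpow D (n - i) b) =
    \sum_(i < n.+2) i%:R *: (divpow D i a * divpow D (n.+1 - i) b).
  by rewrite [RHS]big_ord_recl scale0r add0r.
have -> : \sum_(i < n.+1) (n - i).+1%:R *: (divpow D i a * divpow D (n - i).+1 b) =
    \sum_(i < n.+2) (n.+1 - i)%:R *: (divpow D i a * divpow D (n.+1 - i) b).
  rewrite [RHS]big_ord_recr /= subnn scale0r addr0; apply: eq_bigr => i _.
  by rewrite subSn // -ltnS.
rewrite -big_split /=; apply: eq_bigr => i _.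
by rewrite -scalerDl -natrD subnKC // -ltnS.
Qed.

(** Serves only to see that a product is killed by a high power of [D], so the coefficients are left
    unspecified. *)
Lemma iterM D n a b : lnd D ->
  exists c : nat -> K,
   iter n D (a * b) = \sum_(i < n.+1) c i *: (iter i D a * iter (n - i) D b).
Proof.
move=> hD; exists (fun i => n`!%:R * (i`!%:R^-1 * (n - i)`!%:R^-1)).
have nf : (n`!%:R : K) != 0 by rewrite natr_neq0 ?fact_gt0.
rewrite -[LHS](scalerKV nf) -/(divpow D n _) divpowM // scaler_sumr.
apply: eq_bigr => i _.
by rewrite /divpow -scalerAl -scalerAr !scalerA mulrA.
Qed.

(** This is $\exp(TD)(a)$ for an indeterminate $T$; specializing $T$ to scalars gives the
    one-parameter group. *)
Definition taylor D N a : {poly A} := \poly_(k < N) divpow D k a.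

Lemma coef_taylor D N a k : lnd D -> iter N D a = 0 ->
  (taylor D N a)`_k = divpow D k a.
Proof. by move=> hD h; rewrite coef_poly; case: ltnP => // /divpow_le->. Qed.

Lemma taylor_uniq D N M a : lnd D -> iter N D a = 0 -> iter M D a = 0 ->
  taylor D N a = taylor D M a.
Proof. by move=> hD hN hM; apply/polyP => i; rewrite !coef_taylor. Qed.

Lemma iter_scale D (t : K) k a : lnd D ->
  iter k (fun u => t *: D u) a = t ^+ k *: iter k D a.
Proof.
move=> /lnd_linear[L ->]; elim: k => [|k IHk]; first by rewrite expr0 scale1r.
by rewrite !iterS IHk linearZ /= scalerA exprS.
Qed.

Lemma lnd_scale D (t : K) : lnd D -> lnd (fun u => t *: D u).
Proof.
move=> hD; have [L DL] := lnd_linear hD; split.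
- by move=> c u w; rewrite DL linearP scalerDr !scalerA mulrC.
- by move=> u w; rewrite (lndM hD) scalerDr scalerAl scalerAr.
- by move=> a; have [N h] := lnd_nilp hD a; exists N; rewrite iter_scale // h scaler0.
Qed.

Lemma lnd1 D : lnd D -> D 1 = 0.
Proof.
move=> hD; have := lndM hD 1 1.
by rewrite !mulr1 mul1r -{1}[D 1]addr0 => /addrI.
Qed.

Lemma iter_mull D f k a : lnd D -> D f = 0 ->
  iter k (fun u => f * D u) a = f ^+ k * iter k D a.
Proof.
move=> hD Df; have DX i : D (f ^+ i) = 0.
  elim: i => [|i IHi]; first by rewrite expr0 lnd1.
  by rewrite exprS (lndM hD) Df IHi mul0r mulr0 addr0.
elim: k => [|k IHk]; first by rewrite expr0 mul1r.
by rewrite !iterS IHk (lndM hD) DX mul0r add0r mulrA exprS.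
Qed.

Lemma lnd_mull D f : lnd D -> D f = 0 -> lnd (fun u => f * D u).
Proof.
move=> hD Df; have [L DL] := lnd_linear hD; split.
- by move=> c u w; rewrite DL linearP mulrDr scalerAr.
- by move=> u w; rewrite (lndM hD) mulrDr mulrA mulrCA.
by move=> a; have [N h] := lnd_nilp hD a; exists N; rewrite iter_mull // h mulr0.
Qed.

Lemma taylor1 D N a : (taylor D N a).[1] = \sum_(k < N) divpow D k a.
Proof.
by rewrite horner_poly; under eq_bigr do rewrite expr1n mulr1.
Qed.

Lemma exp_lndE D N a : lnd D -> iter N D a = 0 ->
  exp_lnd D a = (taylor D N a).[1].
Proof.
move=> hD h; pose P := [set M | iter M D a = 0].
have PM : P (xget 0%N P) by apply: (@xgetPex _ 0%N P); exists N.
by rewrite (taylor_uniq hD h PM) taylor1.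
Qed.

Lemma exp_lnd_taylor D N a (t : K) : lnd D -> iter N D a = 0 ->
  exp_lnd (fun u => t *: D u) a = (taylor D N a).[t%:A].
Proof.
move=> hD h; rewrite (@exp_lndE _ N) ?iter_scale ?h ?scaler0 //; last exact: lnd_scale.
rewrite taylor1 horner_poly; apply: eq_bigr => k _.
rewrite /divpow iter_scale // -scalerAl exprZn expr1n -scalerAr mulr1.
by rewrite scalerA mulrC ?scalerA.
Qed.

Lemma taylorD D N M c a b : lnd D -> iter N D a = 0 -> iter M D b = 0 ->
  exists P, iter P D (c *: a + b) = 0 /\
  taylor D P (c *: a + b) = c%:A *: taylor D N a + taylor D M b.
Proof.
move=> hD ha hb; have [L DL] := lnd_linear hD.
have iterP k : iter k D (c *: a + b) = c *: iter k D a + iter k D b.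
  by elim: k => //= k ->; rewrite DL linearP.
have h : iter (maxn N M) D (c *: a + b) = 0.
  rewrite iterP (iter0_le hD ha) ?leq_maxl // (iter0_le hD hb) ?leq_maxr //.
  by rewrite scaler0 addr0.
exists (maxn N M); split=> //; apply/polyP => i.
rewrite coefD coefZ !coef_taylor // /divpow iterP scalerDr.
by rewrite -scalerAl mul1r scalerA mulrC -scalerA.
Qed.

Lemma taylorM D N M a b : lnd D -> iter N D a = 0 -> iter M D b = 0 ->
  exists P, iter P D (a * b) = 0 /\
  taylor D P (a * b) = taylor D N a * taylor D M b.
Proof.
move=> hD ha hb; exists (N + M)%N.
have h : iter (N + M) D (a * b) = 0.
  have [c ->] := iterM (N + M) a b hD; apply: big1 => i _.
  case: (leqP N i) => hi; first by rewrite (iter0_le hD ha hi) mul0r scaler0.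
  by rewrite (iter0_le hD hb) ?mulr0 ?scaler0 // leq_subRL ?leq_add2r; lia.
split=> //; apply/polyP => i.
rewrite coefM coef_taylor // divpowM //.
by apply: eq_bigr => j _; rewrite !coef_taylor.
Qed.

Lemma exp_lnd_lrmorphism D : lnd D ->
  exists phi : {lrmorphism A -> A}, phi =1 exp_lnd D.
Proof.
move=> hD.
have lin : linear (exp_lnd D).
  move=> c a b; have [N ha] := lnd_nilp hD a; have [M hb] := lnd_nilp hD b.
  have [P [hP E]] := taylorD c hD ha hb.
  rewrite (exp_lndE hD hP) (exp_lndE hD ha) (exp_lndE hD hb) E.
  by rewrite hornerD hornerZ -scalerAl mul1r.
have mul : monoid_morphism (exp_lnd D).
  split=> [|a b].
    by rewrite (exp_lndE hD (lnd1 hD : iter 1 D 1 = 0)) taylor1 big_ord1 divpow0.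
  have [N ha] := lnd_nilp hD a; have [M hb] := lnd_nilp hD b.
  have [P [hP E]] := taylorM hD ha hb.
  by rewrite (exp_lndE hD hP) (exp_lndE hD ha) (exp_lndE hD hb) E hornerM.
pose phi : {lrmorphism A -> A} := HB.pack (exp_lnd D)
  (GRing.isLinear.Build K A A *:%R (exp_lnd D) lin)
  (GRing.isMonoidMorphism.Build A A (exp_lnd D) mul).
by exists phi.
Qed.

Lemma iter_divpow D k l a : lnd D ->
  divpow D l (divpow D k a) = 'C(k + l, k)%:R *: divpow D (k + l) a.
Proof.
move=> hD; have [L DL] := lnd_linear hD; rewrite /divpow.
have -> c : iter l D (c *: iter k D a) = c *: iter (k + l) D a.
  rewrite addnC iterD; elim: l => //= l ->.
  by rewrite DL linearZ.
rewrite !scalerA; congr (_ *: _).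
rewrite -(bin_fact (leq_addr l k)) addKn !natrM !invfM mulVKf; first exact: mulrC.
by rewrite natr_neq0 // bin_gt0 leq_addr.
Qed.

(** Taylor expansion at $s$ of the polynomial $\exp(TD)(a)$: its $i$-th divided derivative is
    $\exp(TD)$ of the $i$-th divided power, by [iter_divpow]. *)
Lemma exp_lndD D (s t : K) a : lnd D ->
  exp_lnd (fun u => s *: D u) (exp_lnd (fun u => t *: D u) a) =
  exp_lnd (fun u => (s + t) *: D u) a.
Proof.
move=> hD; have [N ha] := lnd_nilp hD a; have [L DL] := lnd_linear hD.
have [phi E] := exp_lnd_lrmorphism (lnd_scale s hD).
have iterZ M c u : iter M D (c *: u) = c *: iter M D u.
  by elim: M => //= k ->; rewrite DL linearZ.
rewrite (exp_lnd_taylor t hD ha) horner_poly -E linear_sum.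
rewrite (exp_lnd_taylor _ hD ha) scalerDl (nderiv_taylor_wide (n := N)).
- apply: eq_bigr => i _; rewrite exprZn expr1n -!scalerAr !mulr1 linearZ /=.
  rewrite E; congr (_ *: _).
  have hi : iter N D (divpow D i a) = 0.
    by rewrite iterZ -iterD (iter0_le hD ha) ?leq_addr // scaler0.
  rewrite (exp_lnd_taylor _ hD hi); congr (_.[_]); apply/polyP => k.
  by rewrite coef_nderivn !coef_taylor // iter_divpow // scaler_nat.
- exact: mulrC.
- exact: size_poly.
Qed.

Lemma exp_lnd0 D a : lnd D -> exp_lnd (fun u => 0 *: D u) a = a.
Proof.
move=> hD; have [N ha] := lnd_nilp hD a.
rewrite (exp_lnd_taylor _ hD (iter0_le hD ha (leqnSn N))).
by rewrite scale0r horner_coef0 coef_taylor ?divpow0 // (iter0_le hD ha).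
Qed.

End LocallyNilpotent.

(** * Rational polyhedral cones and Demazure roots *)

Section Pairing.
Variables (R : comPzRingType) (n : nat).
Implicit Types (u w : 'rV[R]_n) (m : 'cV[R]_n).

Lemma pairingDl u w m : pairing (u + w) m = pairing u m + pairing w m.
Proof. by rewrite /pairing mulmxDl mxE. Qed.
Lemma pairingDr u m m' : pairing u (m + m') = pairing u m + pairing u m'.
Proof. by rewrite /pairing mulmxDr mxE. Qed.
Lemma pairingNl u m : pairing (- u) m = - pairing u m.
Proof. by rewrite /pairing mulNmx mxE. Qed.
Lemma pairingNr u m : pairing u (- m) = - pairing u m.
Proof. by rewrite /pairing mulmxN mxE. Qed.
Lemma pairingZl c u m : pairing (c *: u) m = c * pairing u m.
Proof. by rewrite /pairing -scalemxAl mxE. Qed.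
Lemma pairingZr c u m : pairing u (c *: m) = c * pairing u m.
Proof. by rewrite /pairing -scalemxAr mxE. Qed.
Lemma pairing0l m : pairing (0 : 'rV[R]_n) m = 0.
Proof. by rewrite /pairing mul0mx mxE. Qed.
Lemma pairing0r u : pairing u (0 : 'cV[R]_n) = 0.
Proof. by rewrite /pairing mulmx0 mxE. Qed.
End Pairing.

Lemma pairing_map n (v : 'rV[int]_n) (m : 'cV[int]_n) :
  pairing (map_mx intr v : 'rV[rat]_n) (map_mx intr m) = (pairing v m)%:~R.
Proof. by rewrite /pairing -map_mxM mxE. Qed.

(** * Cones generated by a list of vectors, and Farkas' lemma *)

Section FinitelyGeneratedCone.
Variable n : nat.
Implicit Types (s t : seq 'rV[rat]_n) (u w g : 'rV[rat]_n) (x m : 'cV[rat]_n).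

(** Recursion on the generators fits the induction in [farkas], which removes them one at a time. *)
Fixpoint incone s u : Prop :=
  if s is g :: s' then exists2 c, 0 <= c & incone s' (u - c *: g) else u = 0.

Lemma incone0 s : incone s 0.
Proof. by elim: s => //= g s IHs; exists 0; rewrite ?scale0r ?subr0. Qed.

Lemma inconeD s u w : incone s u -> incone s w -> incone s (u + w).
Proof.
elim: s u w => [|g s IHs] u w /=; first by move=> -> ->; rewrite addr0.
move=> [c c0 hc] [d d0 hd]; exists (c + d); first exact: addr_ge0.
by rewrite scalerDl opprD addrACA; apply: IHs.
Qed.

Lemma inconeZ s c u : 0 <= c -> incone s u -> incone s (c *: u).
Proof.
move=> c0; elim: s u => [|g s IHs] u /=; first by move=> ->; rewrite scaler0.
move=> [d d0 hd]; exists (c * d); first exact: mulr_ge0.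
by rewrite -scalerA -scalerBr; apply: IHs.
Qed.

Lemma incone_mem s g : g \in s -> incone s g.
Proof.
elim: s => //= h s IHs; rewrite inE => /predU1P[->|/IHs hs].
  by exists 1; rewrite // scale1r subrr; apply: incone0.
by exists 0; rewrite // scale0r subr0.
Qed.

Lemma incone_sub s (C : set 'rV[rat]_n) : C 0 ->
  (forall u w, C u -> C w -> C (u + w)) ->
  (forall c u, 0 <= c -> C u -> C (c *: u)) ->
  (forall g, g \in s -> C g) -> forall u, incone s u -> C u.
Proof.
move=> C0 CD CZ; elim: s => [_ u -> //|g s IHs Cs u /= [c c0 hc]].
rewrite -(subrK (c *: g) u); apply: CD.
  by apply: IHs hc => h hs; apply: Cs; rewrite inE hs orbT.
by apply: CZ => //; apply: Cs; rewrite inE eqxx.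
Qed.

Lemma incone_subset s t : (forall g, g \in s -> incone t g) ->
  forall u, incone s u -> incone t u.
Proof.
by apply: incone_sub; [exact: incone0|exact: inconeD|move=> *; exact: inconeZ].
Qed.

Lemma incone_ge0 s x : (forall g, g \in s -> 0 <= pairing g x) ->
  forall u, incone s u -> 0 <= pairing u x.
Proof.
apply: (@incone_sub s [set u | 0 <= pairing u x]) => /=.
- by rewrite pairing0l.
- by move=> u w hu hw; rewrite pairingDl addr_ge0.
- by move=> c u hc hu; rewrite pairingZl mulr_ge0.
Qed.

Lemma incone_gt0 s x : (forall g, g \in s -> 0 < pairing g x) ->
  forall u, incone s u -> pairing u x = 0 -> u = 0.
Proof.
elim: s => [_ u //|g s IHs hs u /= [c c0 hc]] hu.
have hs' h : h \in s -> 0 < pairing h x by move=> h'; apply: hs; rewrite inE h' orbT.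
have gx : 0 < pairing g x by apply: hs; rewrite inE eqxx.
have := incone_ge0 (fun h hh => ltW (hs' h hh)) hc.
rewrite pairingDl hu add0r pairingNl pairingZl oppr_ge0 pmulr_lle0 // => c0'.
have {c0 c0'} c0 : c = 0 by apply/le_anti; rewrite c0 c0'.
by move: hc; rewrite c0 scale0r subr0 => hc; exact: IHs hc hu.
Qed.

(* Farkas' lemma.  In the inductive step a vector [x0] violating the conclusion
   for [s] must be negative on [g]; project everything along [g] to the
   annihilator of [x0]. *)
Lemma farkas s b :
  (forall x, (forall g, g \in s -> 0 <= pairing g x) -> 0 <= pairing b x) ->
  incone s b.
Proof.
have [k] := ubnP (size s); elim: k s b => // k IHk [|g s] b /= sz hb.
  apply/matrixP => i j; rewrite [i]ord1 mxE.
  have E : pairing b (delta_mx j 0) = b 0 j by rewrite /pairing -colE mxE.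
  have := hb (- delta_mx j 0) (fun g => ltac:(done)).
  rewrite pairingNr oppr_ge0 E => h; apply/le_anti; rewrite h -E.
  exact: hb.
have [ex|nex] := pselect (exists2 x0, (forall h, h \in s -> 0 <= pairing h x0) &
    pairing b x0 < 0); last first.
  exists 0; rewrite // scale0r subr0; apply: IHk => // x hx.
  by rewrite leNgt; apply/negP => bx; apply: nex; exists x.
have [x0 hs bx0] := ex.
have gx0 : pairing g x0 < 0.
  rewrite ltNge; apply/negP => gx0; move: bx0; rewrite ltNge hb // => h.
  by rewrite inE => /predU1P[->|/hs].
(* The coefficient [k0 h] is the one that makes [pr h] vanish on [x0]. *)
pose k0 (h : 'rV[rat]_n) := pairing h x0 / pairing g x0.
pose pr (h : 'rV[rat]_n) := h - k0 h *: g.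
have prE h x : pairing (pr h) x = pairing h (x - (pairing g x / pairing g x0) *: x0).
  rewrite /pr /k0 pairingDl pairingDr pairingNl pairingNr pairingZl pairingZr.
  by congr (_ - _); rewrite mulrAC [RHS]mulrAC (mulrC (pairing g x)).
have [c c0 hc] : exists2 c, 0 <= c & incone s (pr b - c *: g).
  have : incone (map pr s) (pr b).
    apply: IHk => [|x hx]; first by rewrite size_map.
    rewrite prE; apply: hb => h; rewrite inE => /predU1P[->|hs'].
      by rewrite pairingDr pairingNr pairingZr divfK ?subrr // lt_eqF.
    by rewrite -prE; apply: hx; exact: map_f.
  (* As [k0] is nonpositive on [s], each [pr h] is [h] plus a nonnegative multiple of [g], so a
     conic combination of the [pr h] lifts to the [h]. *)
  move: (pr b); have {hb IHk sz} : forall h, h \in s -> k0 h <= 0.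
    by move=> h /hs h0; rewrite mulr_ge0_le0 // invr_le0 ltW.
  elim: s {hs ex} => [|h s IHs] hk w /= => [->|[d d0 hd]].
    by exists 0; rewrite // scale0r subr0.
  have hk' h' : h' \in s -> k0 h' <= 0 by move=> h's; apply: hk; rewrite inE h's orbT.
  have [c c0 hc] := IHs hk' _ hd.
  have kh : 0 <= - k0 h by rewrite oppr_ge0; apply: hk; rewrite inE eqxx.
  exists (c + d * - k0 h); first by rewrite addr_ge0 ?mulr_ge0.
  exists d => //; rewrite (_ : _ - _ = w - d *: pr h - c *: g) //.
  rewrite /pr scalerBr scalerA mulrN scalerDl scaleNr !opprD !opprK -!addrA.
  by congr (_ + _); rewrite [LHS]addrCA [RHS]addrCA; congr (_ + _); apply: addrC.
exists (k0 b + c).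
  by rewrite addr_ge0 // /k0 nmulr_lge0 ?invr_lt0 // ltW.
by rewrite scalerDl opprD addrA.
Qed.

End FinitelyGeneratedCone.

(** * Exposed rays of a strongly convex cone *)

Section Rays.
Variable n : nat.
Variable sigma : set 'rV[rat]_n.
Hypothesis sigma_poly : rational_polyhedral sigma.
Hypothesis sigma_convex : strongly_convex sigma.
Local Notation toQ := (map_mx (intr : int -> rat)).
Implicit Types (v w : 'rV[int]_n) (e m : 'cV[int]_n) (u : 'rV[rat]_n).

Lemma rational_polyhedral_incone :
  exists s : seq 'rV[int]_n, forall u, sigma u <-> incone (map toQ s) u.
Proof.
have [k [g ->]] := sigma_poly; exists (map g (enum 'I_k)) => u; split.
  case=> c c0 ->; rewrite -map_comp -big_enum /=.
  elim: (enum _) => [|i r IHr] /=; first by rewrite big_nil.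
  by exists (c i); rewrite // big_cons addrAC subrr add0r.
apply: incone_sub u.
- by exists (fun=> 0) => //; rewrite big1 // => i _; rewrite scale0r.
- move=> u w [c c0 ->] [d d0 ->]; exists (fun i => c i + d i).
    by move=> i; rewrite addr_ge0.
  by rewrite -big_split; apply: eq_bigr => i _; rewrite scalerDl.
- move=> a u a0 [c c0 ->]; exists (fun i => a * c i).
    by move=> i; rewrite mulr_ge0.
  by rewrite scaler_sumr; apply: eq_bigr => i _; rewrite scalerA.
move=> u; rewrite -map_comp => /mapP[i _ ->].
exists (fun j => (j == i)%:R) => [j|]; first exact: ler0n.
by rewrite (bigD1 i) //= eqxx scale1r big1 ?addr0 // => j /negPf->; rewrite scale0r.
Qed.

Lemma irredundant_generators : exists s : seq 'rV[int]_n,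
  (forall u, sigma u <-> incone (map toQ s) u) /\
  forall g, g \in s -> ~ incone (map toQ (rem g s)) (toQ g).
Proof.
have ex : exists k, `[< exists2 s : seq 'rV[int]_n, size s = k &
    forall u, sigma u <-> incone (map toQ s) u >].
  by have [s hs] := rational_polyhedral_incone; exists (size s); apply/asboolP; exists s.
case: (ex_minnP ex) => k /asboolP[s sk hs] mink; exists s; split=> // g gs hg.
suff : (k <= size (rem g s))%N.
  by rewrite size_rem // sk leqNgt prednK ?leqnn // -sk; case: (s) gs.
apply: mink; apply/asboolP; exists (rem g s) => // u; rewrite hs; split.
  apply: incone_subset => h /mapP[h' h's ->].
  have [->//|ne] := eqVneq h' g.
  apply: incone_mem; apply: map_f; move: h's.
  by rewrite (perm_mem (perm_to_rem gs)) inE (negPf ne).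
apply: incone_subset => h /mapP[h' h's ->].
by apply: incone_mem; apply: map_f; apply: (mem_rem h's).
Qed.

Lemma sigmaZ c u : 0 <= c -> sigma u -> sigma (c *: u).
Proof.
by have [s hs] := rational_polyhedral_incone; rewrite !hs; apply: inconeZ.
Qed.

(** The integer [d] is the largest one dividing [g], bounded by a nonzero coordinate; a further
    divisor of the quotient would contradict maximality. *)
Lemma primitive_generator (g : 'rV[int]_n) : g != 0 ->
  exists (v : 'rV[int]_n) (d : int), [/\ 0 < d, g = d *: v & primitive v].
Proof.
move=> g0; have /rV0Pn[j gj] := g0.
pose P d := `[< exists v : 'rV[int]_n, g = (d%:Z : int) *: v >].
have exP : exists d, P d by exists 1%N; apply/asboolP; exists g; rewrite scale1r.
have Pub d : P d -> (d <= `|g ord0 j|)%N.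
  move=> /asboolP[v gE]; rewrite dvdn_leq ?absz_gt0 //.
  by rewrite gE mxE abszM dvdn_mulr.
case: (ex_maxnP exP Pub) => d /asboolP[v gE] dmax.
have d0 : (0 < d)%N.
  by rewrite lt0n; apply: contraNneq g0 => d0; rewrite gE d0 scale0r.
exists v, d%:Z; split=> // k w vE.
have k0 : k != 0 by apply: contraNneq g0 => k0; rewrite gE vE k0 scale0r scaler0.
have : (d * `|k| <= d)%N.
  apply: dmax; apply/asboolP; exists (sgz k *: w).
  rewrite gE {1}vE {1}[k]intEsg PoszM -!scalerA; congr (_ *: _).
  by rewrite !scalerA mulrC.
rewrite -{2}[d]muln1 leq_pmul2l // => k1.
have {}k1 : `|k|%N = 1%N by apply/eqP; rewrite eqn_leq k1 absz_gt0.
by rewrite -abszE k1.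
Qed.

(** In an irredundant system every generator [g] spans an exposed ray. For another generator [h],
    Farkas' lemma gives a functional in the dual cone vanishing on [g] and positive on [h].
    Otherwise $-h$ is in the cone over $-g$ and the generators, and then either $-h$ lies in
    [sigma], against strong convexity, or [g] is redundant. The sum of these functionals exposes
    [g]. *)
Lemma exposed_generator : exists s : seq 'rV[int]_n,
  (forall u, sigma u <-> incone (map toQ s) u) /\
  forall g, g \in s -> toQ g != 0 /\ exists2 m : 'cV[rat]_n, dual_cone sigma m &
     forall u, (sigma u /\ pairing u m = 0) <-> exists2 c, 0 <= c & u = c *: toQ g.
Proof.
have [s [hs irr]] := irredundant_generators; exists s; split=> // g gs.
have sub u : sigma u -> exists2 c, 0 <= c & incone (map toQ (rem g s)) (u - c *: toQ g).
  move=> /hs; change (incone (map toQ s) u -> incone (map toQ (g :: rem g s)) u).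
  apply: incone_subset => _ /mapP[h h's ->]; apply: incone_mem; apply: map_f.
  by rewrite -(perm_mem (perm_to_rem gs)).
have rems u : incone (map toQ (rem g s)) u -> sigma u.
  move=> hu; apply/hs; apply: incone_subset hu => _ /mapP[h h's ->].
  by apply: incone_mem; apply: map_f; apply: mem_rem h's.
have sig h : h \in s -> sigma (toQ h).
  by move=> h's; apply/hs; apply: incone_mem; apply: map_f.
have nz h : h \in s -> toQ h != 0.
  by move=> h's; apply/eqP => h0; apply: (irr h h's); rewrite h0; exact: incone0.
have sigD u (w : 'rV[rat]_n) : sigma u -> sigma w -> sigma (u + w).
  by rewrite !hs; exact: inconeD.
split; first exact: nz.
have sep h : h \in rem g s -> exists y, [/\ dual_cone sigma y,
    pairing (toQ g) y = 0 & 0 < pairing (toQ h) y].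
  move=> hr; have h's := mem_rem hr.
  apply: contrapT => nex.
  have : incone (map toQ (- g :: s)) (- toQ h).
    apply: farkas => y hy; rewrite leNgt; apply/negP => hlt; apply: nex.
    have gy : 0 <= pairing (toQ g) y by apply: hy; apply: map_f; rewrite inE gs orbT.
    exists y; split.
    - move=> u /hs; apply: incone_ge0 => g' /mapP[h' h's' ->]; apply: hy.
      by apply: map_f; rewrite inE h's' orbT.
    - apply/le_anti; rewrite gy andbT -oppr_ge0 -pairingNl -map_mxN.
      by apply: hy; apply: map_f; rewrite inE eqxx.
    - by rewrite -oppr_lt0 -pairingNl.
  rewrite /= => -[c c0]; rewrite map_mxN scalerN opprK => /hs/sub[c1 c10 hw].
  set w := _ - _ in hw.
  have wE : w + toQ h = (c - c1) *: toQ g.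
    by rewrite /w scalerBl -!addrA addrC -!addrA subrr addr0.
  case: (leP c c1) => [le_c|lt_c].
    case/negP: (nz _ h's); apply/eqP; apply: sigma_convex; first exact: sig.
    have -> : - toQ h = w + (c1 - c) *: toQ g.
      by apply/eqP; rewrite -opprB scaleNr -wE opprD addrA subrr add0r.
    by apply: sigD; [exact: rems|apply: sigmaZ; [rewrite subr_ge0|exact: sig]].
  apply: (irr g gs).
  have -> : toQ g = (c - c1)^-1 *: (w + toQ h).
    by rewrite wE scalerK // subr_eq0 gt_eqF.
  apply: inconeZ; first by rewrite invr_ge0 subr_ge0 ltW.
  by apply: inconeD => //; apply: incone_mem; apply: map_f.
have [y [ys yg yr]] : exists y, [/\ dual_cone sigma y, pairing (toQ g) y = 0 &
    forall h, h \in rem g s -> 0 < pairing (toQ h) y].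
  have : {subset rem g s <= rem g s} by [].
  elim: {1 3}(rem g s) => [_|h r IHr hr].
    by exists 0; split=> // [u _|]; rewrite pairing0r.
  have [|y [ys yg yr]] := IHr; first by move=> h' h'r; apply: hr; rewrite inE h'r orbT.
  have [z [zs zg zh]] := sep h (hr h (mem_head _ _)).
  exists (y + z); split.
  - by move=> u su; rewrite pairingDr addr_ge0 ?ys ?zs.
  - by rewrite pairingDr yg zg addr0.
  move=> h'; rewrite inE pairingDr => /predU1P[->|h'r].
    by rewrite ltr_wpDl // ys //; apply: sig; apply: mem_rem (hr h (mem_head _ _)).
  rewrite ltr_wpDr ?yr // zs //; apply: sig.
  by apply: mem_rem (hr h' _); rewrite inE h'r orbT.
exists y => // u; split.
  case=> /sub[c c0 hw] uy; exists c => //; apply/eqP; rewrite -subr_eq0; apply/eqP.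
  apply: (incone_gt0 (x := y) _ hw) => [h'|]; last first.
    by rewrite pairingDl uy pairingNl pairingZl yg mulr0 subr0.
  by move=> /mapP[h hr ->]; exact: yr.
by case=> c c0 ->; rewrite pairingZl yg mulr0; split=> //; apply: sigmaZ => //; exact: sig.
Qed.

(** The third property makes $\partial_e$ well defined. Membership in the dual cone is tested on
    exposed generators: away from the ray of [v] the root is nonnegative, and on that ray a positive
    integral pairing absorbs the $-1$. *)
Lemma demazure_rootP e v : demazure_root sigma e v ->
  [/\ pairing v e = -1,
      forall m, m \in dual_lattice sigma -> 0 <= pairing v m &
      forall m, m \in dual_lattice sigma -> 0 < pairing v m ->
        m + e \in dual_lattice sigma].
Proof.
case=> tau [[[m0 m0s tauE] [u0 [tu0 u0n0 taul]]] [vprim tv] ve he].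
have sv : sigma (toQ v) by move: tv; rewrite tauE => -[].
have vm m : m \in dual_lattice sigma -> 0 <= pairing v m.
  by move=> /asboolP/(_ _ sv); rewrite pairing_map ler0z.
have vn0 : toQ v != 0.
  apply/eqP => v0; have v0' : v = 0.
    apply/matrixP => i j; have /matrixP/(_ i j) := v0.
    by rewrite !mxE => /eqP; rewrite intr_eq0 => /eqP.
  by have := vprim 0 0; rewrite v0' scale0r normr0 => /(_ erefl)/eqP; rewrite eq_sym oner_eq0.
split=> // m mS mv; apply/asboolP.
have [s [hs ex]] := exposed_generator.
move=> u /hs; apply: incone_ge0 => _ /mapP[g gs ->].
have [gn0 [y ys yg]] := ex g gs.
have g0 : g != 0 by apply: contraNneq gn0 => ->; rewrite map_mx0.
have [v' [d [d0 gE v'p]]] := primitive_generator g0.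
have gQ : toQ g = d%:~R *: toQ v'.
  by apply/matrixP => i j; rewrite gE !mxE intrM.
have dQ : 0 < (d%:~R : rat) by rewrite ltr0z.
pose tau' := sigma `&` [set u | pairing u y = 0].
have tv' : tau' (toQ v').
  apply/(yg (toQ v')); exists (d%:~R^-1); first by rewrite invr_ge0 ltW.
  by rewrite gQ scalerK // gt_eqF.
have rt' : ray sigma tau'.
  split; first by exists y.
  exists (toQ g); split=> //; first by apply/(yg (toQ g)); exists 1; rewrite ?scale1r.
  by move=> w /(yg w)[c _ ->]; exists c.
suff : 0 <= pairing v' (m + e).
  by rewrite gQ pairingZl pairing_map => h; rewrite mulr_ge0 ?ler0z // ltW.
have [tt'|ne] := pselect (tau' = tau); last first.
  rewrite pairingDr addr_ge0 //; last exact: he rt' ne (conj v'p tv').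
  by move/asboolP: mS => /(_ _ (proj1 tv')); rewrite pairing_map ler0z.
(* Both [v] and [v'] lie on this ray, so [v] is a positive multiple of [v'] and the sign can be read
   off on [v]. *)
have : tau' (toQ v) by rewrite tt'.
move/(yg (toQ v)) => -[c c0 vE].
have c_gt0 : 0 < c.
  by rewrite lt_neqAle c0 andbT eq_sym; apply: contraNneq vn0 => c00; rewrite vE c00 scale0r.
have : 0 <= pairing v (m + e) by rewrite pairingDr ve subr_ge0.
rewrite -(ler0z rat) -pairing_map vE gQ !pairingZl pairing_map.
by rewrite !pmulr_rge0 // ler0z.
Qed.

End Rays.

(** * Spans over the rationals and extension of characters *)

(** A subfamily with span of maximal dimension works. It reduces conditions on infinitely many
    weights or roots to finitely many. *)
Lemma finite_span (F : fieldType) (V : vectType F) (I : eqType) (f : I -> V)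
  (P : I -> Prop) :
  exists s : seq I, (forall i, i \in s -> P i) /\
    forall i, P i -> f i \in <<map f s>>%VS.
Proof.
pose Q k := `[< exists s : seq I, (forall i, i \in s -> P i) /\ \dim <<map f s>>%VS = k >].
have exQ : exists k, Q k by exists (\dim <<[::] : seq V>>%VS); apply/asboolP; exists [::].
have ubQ k : Q k -> (k <= \dim {: V})%N.
  by move=> /asboolP[s [_ <-]]; rewrite dimvS ?subvf.
case: (ex_maxnP exQ ubQ) => k /asboolP[s [sP dk]] kmax; exists s; split=> // i Pi.
have sub : (<<map f s>> <= <<map f (i :: s)>>)%VS.
  by apply: sub_span => u us; rewrite /= inE us orbT.
have : (\dim <<map f (i :: s)>> <= \dim <<map f s>>)%N.
  rewrite dk; apply: kmax; apply/asboolP; exists (i :: s); split=> // j.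
  by rewrite inE => /predU1P[->|/sP].
move=> le; have /eqP -> : (<<map f s>> == <<map f (i :: s)>>)%VS by rewrite eqEdim sub.
by apply: memv_span; rewrite /= inE eqxx.
Qed.

Section IntegralSpan.
Variable n : nat.
Local Notation toQ := (map_mx (intr : int -> rat)).

Lemma toQ_inj p q : injective (toQ : 'M[int]_(p, q) -> 'M[rat]_(p, q)).
Proof.
move=> u w /matrixP h; apply/matrixP => i j; have := h i j.
by rewrite !mxE => /eqP; rewrite eqr_int => /eqP.
Qed.

Variable C : 'cV[int]_n -> Prop.
Hypothesis C0 : C 0.
Hypothesis CD : forall u w, C u -> C w -> C (u + w).
Hypothesis CN : forall u, C u -> C (- u).

Lemma closed_scale (z : int) u : C u -> C (z *: u).
Proof.
move=> Cu; have Cn (k : nat) : C (k%:Z *: u).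
  elim: k => [|k IHk]; first by rewrite scale0r.
  by rewrite intS scalerDl scale1r; apply: CD.
by case: z => k //; rewrite NegzE scaleNr; apply: CN.
Qed.

(** Clearing denominators brings a rational combination into the subgroup [C]. *)
Lemma span_integral (s : seq 'cV[int]_n) : (forall u, u \in s -> C u) ->
  forall w : 'cV[rat]_n, w \in <<map toQ s>>%VS ->
  exists (N : int) z, [/\ 0 < N, C z & N%:~R *: w = toQ z].
Proof.
elim: s => [|u s IHs] hs w /=.
  rewrite span_nil memv0 => /eqP->; exists 1, 0.
  by rewrite scaler0 map_mx0; split.
rewrite span_cons => /memv_addP[_ /vlineP[c ->] [w' hw' ->]].
have [|N [z [N0 Cz E]]] := IHs _ w' hw'.
  by move=> u' us; apply: hs; rewrite inE us orbT.
exists (N * denq c), ((N * numq c) *: u + denq c *: z); split.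
- by rewrite mulr_gt0 // denq_gt0.
- by apply: CD; apply: closed_scale => //; apply: hs; rewrite inE eqxx.
rewrite map_mxD !map_mxZ /= scalerDr; congr (_ + _).
  rewrite scalerA !intrM -mulrA; congr ((_ * _) *: _).
  by rewrite numqE mulrC.
by rewrite intrM mulrC -scalerA E.
Qed.

End IntegralSpan.

Section CharacterExtension.
Variables (K : closedFieldType) (n : nat).

Implicit Types (L : 'cV[int]_n -> Prop) (r : 'cV[int]_n -> K) (v : 'rV[int]_n).

Lemma closed_root (a : K) d : (0 < d)%N -> a != 0 -> exists2 b, b != 0 & b ^+ d = a.
Proof.
move=> d0 a0; have sz : size ('X^d - a%:P) = d.+1.
  by rewrite size_XnsubC.
have /closed_rootP[b] : size ('X^d - a%:P) != 1%N by rewrite sz; case: (d) d0.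
rewrite rootE !hornerE subr_eq0 => /eqP hb; exists b => //.
by apply: contraNneq a0 => b0; rewrite -hb b0 expr0n eqn0Ngt d0.
Qed.

(** A character $L \to \mathbb{K}^*$ of a subgroup; [r] is total, but only its values on [L]
    matter. *)
Definition subgroup_character L r : Prop :=
  [/\ L 0, forall u w, L u -> L w -> L (u - w), forall u, L u -> r u != 0 &
      forall u w, L u -> L w -> r (u + w) = r u * r w].

Lemma subgroup_characterZ L r : subgroup_character L r ->
  forall (z : int) u, L u -> L (z *: u) /\ r (z *: u) = r u ^ z.
Proof.
case=> L0 LB rn rD z u Lu.
have LN w : L w -> L (- w) by move=> Lw; rewrite -[- w]add0r; apply: LB.
have LD w w' : L w -> L w' -> L (w + w').
  by move=> Lw /LN Lw'; rewrite -[w']opprK; apply: LB.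
have r0 : r 0 = 1.
  by apply: (mulfI (rn 0 L0)); rewrite -rD // addr0 mulr1.
have pos (k : nat) : L (k%:Z *: u) /\ r (k%:Z *: u) = r u ^+ k.
  elim: k => [|k [Lk rk]]; first by rewrite scale0r expr0.
  by rewrite intS scalerDl scale1r rD // rk exprS; split=> //; apply: LD.
case: z => k; first exact: pos.
have [Lk rk] := pos k.+1; rewrite NegzE scaleNr; split; first exact: LN.
apply: (mulfI (rn _ Lk)); rewrite -rD ?subrr ?r0 //; last exact: LN.
by rewrite rk -exprnN mulfV // expf_neq0 // rn.
Qed.

(** Pairing with [v] maps [L] onto some $d\mathbb{Z}$ and [r] factors through it. If $d > 0$, [c] is
    a $d$-th root of the value of [r] at an element [u0] over $d$, which exists because [K] is
    algebraically closed. *)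
Lemma character_extension1 L r v : subgroup_character L r ->
  (forall u, L u -> pairing v u = 0 -> r u = 1) ->
  exists2 c, c != 0 & forall u, L u -> r u = c ^ pairing v u.
Proof.
move=> hr triv; have [L0 LB rn rD] := hr.
have [all0|nall0] := pselect (forall u, L u -> pairing v u = 0).
  by exists 1; rewrite ?oner_neq0 // => u Lu; rewrite exp1rz triv // all0.
have exd : exists d, `[< exists u, [/\ L u, (0 < d)%N & pairing v u = d%:Z] >].
  have [u /not_implyP[Lu /eqP vu]] : exists u, ~ (L u -> pairing v u = 0) by apply/existsNP.
  exists `|pairing v u|%N; apply/asboolP.
  exists (sgz (pairing v u) *: u); split.
  - by have [] := subgroup_characterZ hr (sgz (pairing v u)) Lu.
  - by rewrite absz_gt0.
  - by rewrite pairingZr abszEsg.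
case: (ex_minnP exd) => d /asboolP[u0 [Lu0 d0 vu0]] dmin.
have [c c0 cd] := closed_root d0 (rn u0 Lu0); exists c => // u Lu.
set q := (pairing v u %/ d)%Z.
have [Lq rq] := subgroup_characterZ hr q Lu0.
have vE : pairing v u = q * d%:Z.
  apply: contrapT => /eqP ne.
  have mE : pairing v (u - q *: u0) = (pairing v u %% d)%Z.
    by rewrite pairingDr pairingNr pairingZr vu0 /modz.
  have m0 : 0 <= (pairing v u %% d)%Z by rewrite modz_ge0 // eqz_nat -lt0n.
  have md : (pairing v u %% d)%Z < d by rewrite ltz_pmod.
  have : (d <= `|(pairing v u %% d)%Z|)%N.
    apply: dmin; apply/asboolP; exists (u - q *: u0); split; first exact: LB.
      by rewrite absz_gt0 -mE pairingDr pairingNr pairingZr vu0 subr_eq0.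
    by rewrite mE gez0_abs.
  by rewrite leqNgt -ltz_nat gez0_abs // md.
have -> : u = (u - q *: u0) + q *: u0 by rewrite subrK.
have Lu' : L (u - q *: u0) by apply: LB.
rewrite rD // triv ?mul1r //; last by rewrite pairingDr pairingNr pairingZr vu0 vE subrr.
by rewrite subrK rq vE -cd mulrC -exprz_exp.
Qed.

(* Characters of $\mathbb{Z}^k$ extend from subgroups because $\mathbb{K}^*$
   is divisible. *)
Lemma character_extension (I : eqType) (v : I -> 'rV[int]_n) (s : seq I) L r :
  subgroup_character L r ->
  (forall u, L u -> (forall i, i \in s -> pairing (v i) u = 0) -> r u = 1) ->
  exists t : seq (I * K), [/\ map fst t = s, all (fun p => p.2 != 0) t &
    forall u, L u -> r u = \prod_(p <- t) p.2 ^ pairing (v p.1) u].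
Proof.
elim: s L r => [|i s IHs] L r hr triv.
  by exists [::]; split=> // u Lu; rewrite big_nil triv.
have [L0 LB rn rD] := hr.
(* The induction hypothesis applies on the kernel of [v i]. Dividing [r] by the product found there
   leaves a character trivial on this kernel, hence a power of a single constant. *)
pose L' u := L u /\ pairing (v i) u = 0.
have hr' : subgroup_character L' r.
  split=> [|u w [Lu vu] [Lw vw]|u [Lu _]|u w [Lu _] [Lw _]].
  - by split; rewrite // pairing0r.
  - by split; [exact: LB|rewrite pairingDr pairingNr vu vw subr0].
  - exact: rn.
  - exact: rD.
have [|t [tE t0 rE]] := IHs L' r hr'.
  by move=> u [Lu vu] h; apply: triv => // j; rewrite inE => /predU1P[->|/h].
pose r1 u := \prod_(p <- t) p.2 ^ pairing (v p.1) u.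
have r1n u : r1 u != 0.
  rewrite /r1; clear - t0 u; elim: t t0 => [|p t IHt] /=; first by rewrite big_nil oner_neq0.
  by case/andP=> p0 /IHt; rewrite big_cons => h; rewrite mulf_neq0 ?expfz_neq0.
have r1D u w : r1 (u + w) = r1 u * r1 w.
  rewrite /r1; clear - t0 u w; elim: t t0 => [|p t IHt] /=; first by rewrite !big_nil mulr1.
  by case/andP=> p0 /IHt; rewrite !big_cons pairingDr expfzDr // mulrACA => ->.
have hr1 : subgroup_character L (fun u => r u / r1 u).
  split=> // [u Lu|u w Lu Lw]; first by rewrite mulf_neq0 ?invr_neq0 ?rn.
  by rewrite rD // r1D invfM mulrACA.
have [|c c0 cE] := character_extension1 (v := v i) hr1.
  by move=> u Lu vu; rewrite (rE u (conj Lu vu)) divff //; exact: r1n.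
exists ((i, c) :: t); split=> /=; [by rewrite tE|by rewrite c0|].
by move=> u Lu; rewrite big_cons -cE // divfK.
Qed.

End CharacterExtension.

(** * The root derivations of a toric algebra *)

Lemma sgscaleU (K : comNzRingType) (S : nmodType) (c : K) (s : S) :
  c *: (<< (1 : K) *g s >> : semigroup_algebra K S) = << c *g s >>.
Proof.
apply/malgP => u; rewrite mcoeffZ !mcoeffU.
by rewrite mulrnAr mulr1.
Qed.

Lemma sgcoeffP (K : comNzRingType) (S : nmodType) (c : K)
  (f g : semigroup_algebra K S) (s : S) : (c *: f + g)@_s = c * f@_s + g@_s.
Proof. by rewrite mcoeffD mcoeffZ. Qed.

Section RootDerivation.
Variables (K : fieldType) (n : nat) (sigma : set 'rV[rat]_n).
Local Notation A := (toric_algebra K sigma).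
Local Notation S := (dual_lattice sigma).
Local Notation chi := (@chi K n sigma).
Variables (e : 'cV[int]_n) (v : 'rV[int]_n).
Local Notation D := (@root_derivation K n sigma e v).

Lemma chi_out m : m \notin S -> chi m = 0.
Proof. by move=> hm; rewrite /Defs.chi insubF //; apply: negPf. Qed.

Lemma chi0 : chi 0 = 1.
Proof. by rewrite -(raddf0 (val : weight sigma -> 'cV[int]_n)) chiE. Qed.

Lemma toric_algebraE (f : A) : f = \sum_(m <- msupp f) f@_m *: chi (val m).
Proof.
rewrite [LHS]sgE; apply: eq_bigr => m _; rewrite chiE.
by rewrite sgscaleU.
Qed.

Lemma toric_algebra_ind (P : A -> Prop) : P 0 ->
  (forall c f g, P f -> P g -> P (c *: f + g)) ->
  (forall m, m \in S -> P (chi m)) -> forall f, P f.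
Proof.
move=> P0 PD Pchi f; rewrite [f]toric_algebraE.
elim: (enum_fset (msupp f)) => [|m r IHr]; first by rewrite big_nil.
by rewrite big_cons; apply: PD => //; apply: Pchi; exact: weightP.
Qed.

Lemma root_derivationw (d : {fset weight sigma}) (f : A) : (msupp f `<=` d)%fset ->
  D f = \sum_(m <- d) (f@_m * (pairing v (val m))%:~R) *: chi (val m + e).
Proof.
move=> le; rewrite /root_derivation (big_fset_incl _ le) //= => m _ /mcoeff_outdom->.
by rewrite mul0r scale0r.
Qed.

Lemma root_derivation_linear : linear D.
Proof.
move=> c f g.
have leh : (msupp (c *: f + g) `<=` msupp f `|` msupp g)%fset.
  exact: (fsubset_trans (msuppD_le _ _) (fsetSU _ (msuppZ_le _ _))).
rewrite (root_derivationw leh) (root_derivationw (fsubsetUl (msupp f) (msupp g))).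
rewrite (root_derivationw (fsubsetUr (msupp f) (msupp g))) scaler_sumr -big_split.
apply: eq_bigr => m _.
by rewrite scalerA mulrA sgcoeffP mulrDl scalerDl.

Qed.

HB.instance Definition _ := GRing.isLinear.Build K A A *:%R D root_derivation_linear.

End RootDerivation.

(** * The action of the root subgroups on points *)

Section RootFlow.
Variables (K : closedFieldType) (n : nat) (sigma : set 'rV[rat]_n).
Hypothesis charK : [pchar K] =i pred0.
Hypothesis sigma_poly : rational_polyhedral sigma.
Hypothesis sigma_convex : strongly_convex sigma.
Local Notation S := (dual_lattice sigma).
(* The properties of the toric algebra and of the root derivations that matter. *)
Variables (A : comAlgType K) (chi : 'cV[int]_n -> A).
Hypothesis chi0 : chi 0 = 1.
Hypothesis chiD : forall m1 m2, m1 \in S -> m2 \in S -> chi (m1 + m2) = chi m1 * chi m2.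
Hypothesis chi_out : forall m, m \notin S -> chi m = 0.
Hypothesis chi_ind : forall P : A -> Prop, P 0 ->
  (forall c f g, P f -> P g -> P (c *: f + g)) ->
  (forall m, m \in S -> P (chi m)) -> forall f, P f.
Variable D : 'cV[int]_n -> 'rV[int]_n -> {linear A -> A}.
Hypothesis D_chi : forall e v m, m \in S ->
  D e v (chi m) = (pairing v m)%:~R *: chi (m + e).
Local Notation root := (demazure_root sigma).
Implicit Types (e m : 'cV[int]_n) (v : 'rV[int]_n) (f : A) (x y : kpoint A).

(* Meant for [m] in the dual lattice and [v] on a ray, so that no sign is lost. *)
Definition height v m : nat := `|pairing v m|%N.

Lemma heightE e v m : root e v -> m \in S -> pairing v m = (height v m)%:Z.
Proof. by move=> /(demazure_rootP sigma_poly sigma_convex)[_ h _] /h/gez0_abs. Qed.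

Lemma heightD e v m1 m2 : root e v -> m1 \in S -> m2 \in S ->
  height v (m1 + m2) = (height v m1 + height v m2)%N.
Proof.
move=> r h1 h2; apply/eqP; rewrite -eqz_nat PoszD -!(heightE r) ?rpredD //.
by rewrite pairingDr.
Qed.

Lemma root_shift e v m k : root e v -> m \in S -> (k <= height v m)%N ->
  m + e *+ k \in S /\ height v (m + e *+ k) = (height v m - k)%N.
Proof.
move=> r hm; have [ve _ hS] := demazure_rootP sigma_poly sigma_convex r.
elim: k => [|k IHk] le_k; first by rewrite mulr0n addr0 subn0.
have [h1 h2] := IHk (ltnW le_k).
have h3 : m + e *+ k.+1 \in S.
  by rewrite mulrSr addrA; apply: hS => //; rewrite (heightE r) // h2 ltz_nat subn_gt0.
split=> //; apply/eqP; rewrite -eqz_nat -(heightE r) // mulrSr addrA pairingDr ve.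
rewrite (heightE r) // h2; lia.
Qed.

Lemma iter_root_derivation e v k m : root e v -> m \in S ->
  iter k (D e v) (chi m) = (height v m ^_ k)%:R *: chi (m + e *+ k).
Proof.
move=> r hm; elim: k => [|k IHk]; first by rewrite ffactn0 scale1r mulr0n addr0.
rewrite iterS IHk linearZ /= ffactnSr natrM -scalerA mulrSr addrA.
have [le_k|lt_k] := leqP k (height v m); last by rewrite ffact_small // !scale0r.
have [h1 h2] := root_shift r hm le_k.
by rewrite D_chi // (heightE r) // h2.
Qed.

Lemma root_derivation_lnd e v : root e v -> lnd (D e v).
Proof.
move=> r; have [_ _ hS] := demazure_rootP sigma_poly sigma_convex r.
have Dchi m : m \in S -> D e v (chi m) = (height v m)%:R *: chi (m + e).
  by move=> hm; rewrite D_chi // (heightE r).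
split; first exact: linearP.
  move=> a b; elim/chi_ind: a => [|c a1 a2 h1 h2|m1 hm1].
  - by rewrite !(mul0r, linear0) addr0.
  - rewrite mulrDl -scalerAl !linearP h1 h2 /= !mulrDl -!scalerAl scalerDr.
    by rewrite addrACA.
  elim/chi_ind: b => [|c b1 b2 h1 h2|m2 hm2].
  - by rewrite !(mulr0, linear0) addr0.
  - rewrite mulrDr -scalerAr !linearP h1 h2 /= !mulrDr -!scalerAr scalerDr.
    by rewrite addrACA.
  rewrite -chiD // !Dchi ?rpredD // (heightD r) // natrD scalerDl -scalerAl -scalerAr.
  (* At height zero [m + e] may leave the dual cone, but then the coefficient vanishes. *)
  have E m m' : m \in S -> m' \in S ->
      (height v m)%:R *: chi (m + m' + e) = (height v m)%:R *: (chi (m + e) * chi m').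
    move=> hm hm'; case E : (height v m) => [|k]; first by rewrite !scale0r.
    have hme : m + e \in S by rewrite hS // (heightE r) // E.
    by rewrite addrAC (chiD hme hm').
  by rewrite E // [m1 + m2]addrC E // [chi m1 * _]mulrC.
elim/chi_ind => [|c a b [N ha] [M hb]|m hm].
- by exists 0%N.
- exists (N + M)%N.
  have it k : iter k (D e v) (c *: a + b) = c *: iter k (D e v) a + iter k (D e v) b.
    by elim: k => //= k ->; rewrite linearP.
  have i0 k : iter k (D e v) 0 = 0 by elim: k => //= k ->; rewrite linear0.
  by rewrite it {1}addnC !iterD ha hb !i0 scaler0 addr0.
exists (height v m).+1.
by rewrite iter_root_derivation // ffact_small // scale0r.
Qed.

(** * Replicas as flows, and the group they generate *)

Definition root_flow e v f : {lrmorphism A -> A} :=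
  if pselect (exists phi : {lrmorphism A -> A}, phi =1 exp_lnd (fun a => f * D e v a))
  is left ex then projT1 (cid ex) else idfun.

Lemma root_flowE e v f : root e v -> D e v f = 0 ->
  root_flow e v f =1 exp_lnd (fun a => f * D e v a).
Proof.
move=> r Df; rewrite /root_flow; case: pselect => [ex|[]]; first exact: projT2 (cid ex).
exact: (exp_lnd_lrmorphism charK (lnd_mull (root_derivation_lnd r) Df)).
Qed.

Lemma root_flowZ e v f (t : K) : root e v -> D e v f = 0 ->
  root_flow e v (t *: f) =1 exp_lnd (fun a => t *: (f * D e v a)).
Proof.
move=> r Df a; rewrite root_flowE ?linearZ /= ?Df ?scaler0 //.
by congr (exp_lnd _ _); apply/funext => b; rewrite scalerAl.
Qed.

Lemma root_flowK e v f : root e v -> D e v f = 0 ->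
  cancel (root_flow e v f) (root_flow e v (- f)).
Proof.
move=> r Df a; have hD := lnd_mull (root_derivation_lnd r) Df.
have -> : root_flow e v f a = exp_lnd (fun b => 1 *: (f * D e v b)) a.
  by rewrite -root_flowZ // scale1r.
rewrite -scaleN1r root_flowZ //.
by rewrite exp_lndD // addNr exp_lnd0.
Qed.

(* $\exp(f\partial_e)(\chi^m) = \chi^m (1 + f\chi^e)^{\langle v, m\rangle}$. *)
Lemma root_flow_chi e v f x m : root e v -> D e v f = 0 -> m \in S ->
  x (root_flow e v f (chi m)) =
  \sum_(k < (height v m).+1) (x f ^+ k * x (chi (m + e *+ k))) *+ 'C(height v m, k).
Proof.
move=> r Df hm; have hD := root_derivation_lnd r.
have hN : iter (height v m).+1 (fun a => f * D e v a) (chi m) = 0.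
  by rewrite iter_mull // iter_root_derivation // ffact_small // scale0r mulr0.
rewrite root_flowE // (exp_lndE (lnd_mull hD Df) hN).
rewrite taylor1 linear_sum; apply: eq_bigr => k _.
rewrite /divpow iter_mull // iter_root_derivation // -scalerAr scalerA.
have -> : k`!%:R^-1 * (height v m ^_ k)%:R = 'C(height v m, k)%:R :> K.
  by rewrite -bin_ffact natrM mulrCA mulVf ?mulr1 // natr_neq0 ?fact_gt0.
by rewrite scaler_nat raddfMn /= rmorphM rmorphXn.
Qed.

(** Source of all general position arguments: along a replica every linear functional varies
    polynomially. *)
Lemma root_flow_poly (phi : {linear A -> K^o}) e v f a : root e v -> D e v f = 0 ->
  exists p : {poly K}, forall t, phi (root_flow e v (t *: f) a) = p.[t].
Proof.
move=> r Df; have hD := lnd_mull (root_derivation_lnd r) Df.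
have [N ha] := lnd_nilp hD a.
exists (\poly_(k < N) phi (divpow (fun a => f * D e v a) k a)) => t.
rewrite root_flowZ // (exp_lnd_taylor _ hD ha) !horner_poly linear_sum.
apply: eq_bigr => k _; rewrite exprZn expr1n -scalerAr mulr1 linearZ.
exact: mulrC.
Qed.

(** For the toric algebra this unfolds to [root_subgroups_and_replicas]. *)
Definition replica_gens : set {lrmorphism A -> A} :=
  [set phi : {lrmorphism A -> A} | exists e v, root e v /\
     (unipotent (D e v) phi \/ replicas (D e v) phi)].
Local Notation G := (generated_group replica_gens).

Lemma root_flow_replica_group e v f : root e v -> D e v f = 0 -> G (root_flow e v f).
Proof.
move=> r Df; apply: gen_mem; exists e, v; split=> //; right; exists f => //.
by exists 1 => a; rewrite -root_flowZ // scale1r.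
Qed.

(** Words need no inverses, because the flow of [- f] inverts that of [f]; this yields an induction
    over the group with one flow at a time. *)
Inductive flow_word : {lrmorphism A -> A} -> Prop :=
| flow_word_id : flow_word idfun
| flow_word_cons e v f psi : root e v -> D e v f = 0 -> flow_word psi ->
    flow_word (root_flow e v f \o psi).

Lemma flow_word_comp phi psi : flow_word phi -> flow_word psi -> flow_word (phi \o psi).
Proof.
move=> hphi hpsi; elim: hphi => [|e v f phi' r Df _ IH].
  by have -> : (idfun \o psi : {lrmorphism A -> A}) = psi by exact: lrmorphismP.
have -> : ((root_flow e v f \o phi') \o psi : {lrmorphism A -> A}) =
    root_flow e v f \o (phi' \o psi) by exact: lrmorphismP.
exact: flow_word_cons.
Qed.

Lemma flow_word_flow e v f : root e v -> D e v f = 0 -> flow_word (root_flow e v f).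
Proof.
move=> r Df; have <- : (root_flow e v f \o idfun : {lrmorphism A -> A}) = root_flow e v f.
  exact: lrmorphismP.
by apply: flow_word_cons => //; exact: flow_word_id.
Qed.

Lemma flow_word_inv phi : flow_word phi ->
  exists psi, [/\ flow_word psi, cancel phi psi & cancel psi phi].
Proof.
elim=> [|e v f phi' r Df _ [psi [w psiK psiK']]].
  by exists idfun; split=> //; exact: flow_word_id.
have Df' : D e v (- f) = 0 by rewrite linearN /= Df oppr0.
exists (psi \o root_flow e v (- f)); split.
- by apply: flow_word_comp => //; apply: flow_word_flow.
- apply: can_comp => //=; exact: root_flowK.
- by apply: can_comp => //; rewrite -{2}[f]opprK; exact: root_flowK.
Qed.

Lemma replica_group_word phi : G phi -> flow_word phi.
Proof.
elim=> [{}phi [e [v [r]]]| | |{}phi psi _ w phiK psiK].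
- case=> [[t E]|[f Df [t E]]].
    (* A root subgroup consists of replicas with constant coefficient. *)
    rewrite (_ : phi = root_flow e v (t *: 1)).
      apply: flow_word_flow => //.
      by rewrite linearZ /= (lnd1 (root_derivation_lnd r)) scaler0.
    apply: lrmorphismP => a; rewrite E root_flowZ ?(lnd1 (root_derivation_lnd r)) //.
    by congr (exp_lnd _ _); apply/funext => b; rewrite mul1r.
  rewrite (_ : phi = root_flow e v (t *: f)).
    by apply: flow_word_flow => //; rewrite linearZ /= Df scaler0.
  by apply: lrmorphismP => a; rewrite E root_flowZ.
- exact: flow_word_id.
- by move=> phi' psi _ h1 _ h2; exact: flow_word_comp.
have [psi' [w' phiK' psiK']] := flow_word_inv w.
suff -> : psi = psi' by [].
by apply: lrmorphismP => a; rewrite -{1}[a]psiK' phiK.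
Qed.

Lemma replica_group_inv phi : G phi ->
  exists psi, [/\ G psi, cancel phi psi & cancel psi phi].
Proof.
move=> h; have [psi [_ h1 h2]] := flow_word_inv (replica_group_word h).
by exists psi; split=> //; exact: gen_inv h h1 h2.
Qed.

Lemma replica_group_ind (P : {lrmorphism A -> A} -> Prop) : P idfun ->
  (forall e v f psi, root e v -> D e v f = 0 -> G psi -> P psi ->
     P (root_flow e v f \o psi)) ->
  forall phi, G phi -> P phi.
Proof.
move=> P0 PS phi /replica_group_word w.
suff : G phi /\ P phi by case.
elim: w => [|e v f psi r Df _ [h1 h2]]; first by split=> //; exact: gen_id.
by split; [apply: gen_comp => //; exact: root_flow_replica_group|exact: PS].
Qed.

(** * Points as multiplicative maps, and how flows move them *)

Lemma kpoint_ext x y : (forall m, m \in S -> x (chi m) = y (chi m)) -> x = y.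
Proof.
move=> h; apply/kpointP; elim/chi_ind => [|c a b ha hb|m /h//].
  by rewrite !raddf0.
by rewrite !linearP; congr (c *: _ + _).
Qed.

Lemma kpointZ x (c : K) a : x (c *: a) = c * x a.
Proof. exact: linearZ. Qed.

Lemma kpoint_alg x (c : K) : x (c%:A) = c.
Proof. by rewrite kpointZ rmorph1 mulr1. Qed.

Lemma kpoint_support x m : x (chi m) != 0 -> m \in S.
Proof. by apply: contraNT => /chi_out->; rewrite raddf0. Qed.

Lemma kpoint_chi0 x : x (chi 0) = 1.
Proof. by rewrite chi0 rmorph1. Qed.

Lemma kpoint_chiD x m1 m2 : m1 \in S -> m2 \in S ->
  x (chi (m1 + m2)) = x (chi m1) * x (chi m2).
Proof. by move=> h1 h2; rewrite chiD // rmorphM. Qed.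

Lemma kpoint_chiMn x m k : m \in S -> x (chi (m *+ k)) = x (chi m) ^+ k.
Proof.
move=> hm; elim: k => [|k IHk]; first by rewrite mulr0n kpoint_chi0.
by rewrite mulrS kpoint_chiD ?rpredMn // IHk exprS.
Qed.

(* [active x e] says that $\chi^e$ has a well-defined nonzero value at [x],
   namely [slope x b e] for any [b] as below. *)
Definition active x e : Prop :=
  exists2 b, x (chi b) != 0 & x (chi (b + e)) != 0.

Definition slope x b e : K := x (chi (b + e)) / x (chi b).

Lemma slope_neq0 x b e : x (chi b) != 0 -> x (chi (b + e)) != 0 -> slope x b e != 0.
Proof. by move=> h1 h2; rewrite mulf_neq0 ?invr_neq0. Qed.

(** The products $\chi^{m+ke}(\chi^b)^k$ and $\chi^m(\chi^{b+e})^k$ are the same monomial. *)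
Lemma kpoint_shift x e v b m k : root e v -> x (chi b) != 0 -> x (chi (b + e)) != 0 ->
  m \in S -> (k <= height v m)%N -> x (chi (m + e *+ k)) = x (chi m) * slope x b e ^+ k.
Proof.
move=> r xb xbe hm hk; have [hme _] := root_shift r hm hk.
have hb := kpoint_support xb; have hbe := kpoint_support xbe.
apply: (mulIf (expf_neq0 k xb)).
rewrite -mulrA -exprMn divfK // -!kpoint_chiMn // -!kpoint_chiD ?rpredMn //.
by rewrite mulrnDl addrA addrAC.
Qed.

Lemma flow_active x e v f b m : root e v -> D e v f = 0 ->
  x (chi b) != 0 -> x (chi (b + e)) != 0 -> m \in S ->
  x (root_flow e v f (chi m)) = x (chi m) * (x f * slope x b e + 1) ^+ height v m.
Proof.
move=> r Df xb xbe hm; rewrite root_flow_chi // exprD1n mulr_sumr.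
apply: eq_bigr => k _; rewrite (kpoint_shift r xb xbe hm) -1?ltnS //.
by rewrite mulrnAr mulrCA -exprMn.
Qed.

Lemma flow_kernel x e v f m : root e v -> D e v f = 0 -> m \in S -> x f = 0 ->
  x (root_flow e v f (chi m)) = x (chi m).
Proof.
move=> r Df hm xf; rewrite root_flow_chi // big_ord_recl big1 => [|k _].
  by rewrite bin0 mulr0n mul1r !addr0.
by rewrite xf expr0n mul0r mul0rn.
Qed.

Definition generic x : Prop :=
  forall g, G g -> forall m, x (g (chi m)) != 0 -> x (chi m) != 0.

Lemma generic_act x g : generic x -> G g ->
  (forall m, x (chi m) != 0 -> x (g (chi m)) != 0) -> generic (aut_act g x).
Proof.
move=> gx Gg h g' Gg' m h'; apply: h; apply: (gx (g \o g')) => //.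
exact: gen_comp.
Qed.

Lemma generic_support x g m : G g -> generic (aut_act g x) ->
  x (chi m) != 0 -> x (g (chi m)) != 0.
Proof.
move=> Gg gx xm; have [h [Gh gK hK]] := replica_group_inv Gg.
by apply: (gx h Gh); rewrite /= /aut_act /= hK.
Qed.

(** Suppose a term of positive index in [root_flow_chi] is nonzero at [x], and let $m'$ be the
    weight just before it. Along $\exp(t\partial_e)$ the value of $\chi^{m'}$ is a polynomial in $t$
    with nonzero linear term, so it is nonzero somewhere on the orbit, and at [x] by genericity.
    Then [e] is active. *)
Lemma flow_inactive x e v f a : generic x -> root e v -> D e v f = 0 ->
  ~ active x e -> x (root_flow e v f a) = x a.
Proof.
move=> gx r Df nact; suff : aut_act (root_flow e v f) x = x by move=> {2}<-.
apply: kpoint_ext => m hm; rewrite [LHS]root_flow_chi // big_ord_recl big1 => [|k _].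
  by rewrite bin0 mulr0n mul1r !addr0.
suff -> : x (chi (m + e *+ bump 0 k)) = 0 by rewrite mulr0 mul0rn.
apply/eqP/negPn/negP; rewrite /bump leq0n add1n => xk.
have lek : (k <= height v m)%N by apply: ltnW.
have [hm' hk] := root_shift r hm lek; move: xk; rewrite mulrSr addrA => xk.
apply: nact; exists (m + e *+ k) => //; set m' := _ + _ in hm' hk xk *.
pose p := \poly_(j < (height v m').+1) (x (chi (m' + e *+ j)) *+ 'C(height v m', j)).
have p0 : p != 0.
  apply: contraNneq xk => p0; have : p`_1 = 0 by rewrite p0 coef0.
  rewrite coef_poly hk ltnS subn_gt0 ltn_ord bin1 mulr1n -mulr_natr => /eqP.
  by rewrite mulf_eq0 orbC (negPf (natr_neq0 _ _)) ?subn_gt0 // => /eqP.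
have [t pt] := poly_nonroot charK p0.
have D1 : D e v 1 = 0 by rewrite (lnd1 (root_derivation_lnd r)).
have Dt : D e v (t *: 1) = 0 by rewrite linearZ /= D1 scaler0.
apply: (gx _ (root_flow_replica_group r Dt)); rewrite root_flow_chi //.
move: pt; rewrite horner_poly; congr (_ != 0); apply: eq_bigr => j _.
by rewrite linearZ rmorph1 /= mulrnAl mulrC [t *: 1]mulr1.
Qed.

(** * Irreducibility of the group and general position *)

(** Stand-in for a regular function on the group. The outer factors [a] and [b] make the notion
    stable under translations. *)
Definition regular (F : (A -> A) -> K) : Prop :=
  forall (a b : {lrmorphism A -> A}) e v f, root e v -> D e v f = 0 ->
  exists p : {poly K}, forall t, F (a \o root_flow e v (t *: f) \o b) = p.[t].

Lemma regular_cst c : regular (fun=> c).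
Proof. by move=> *; exists c%:P => t; rewrite hornerC. Qed.

Lemma regular_eval x a : regular (fun g => x (g a)).
Proof.
move=> g h e v f r Df.
exact: (root_flow_poly (x \o g : {linear A -> K^o}) (h a) r Df).
Qed.

Lemma regularM F1 F2 : regular F1 -> regular F2 -> regular (fun g => F1 g * F2 g).
Proof.
move=> h1 h2 a b e v f r Df; have [p1 E1] := h1 a b _ _ _ r Df.
have [p2 E2] := h2 a b _ _ _ r Df.
by exists (p1 * p2) => t; rewrite hornerM E1 E2.
Qed.

Lemma regularB F1 F2 : regular F1 -> regular F2 -> regular (fun g => F1 g - F2 g).
Proof.
move=> h1 h2 a b e v f r Df; have [p1 E1] := h1 a b _ _ _ r Df.
have [p2 E2] := h2 a b _ _ _ r Df.
by exists (p1 - p2) => t; rewrite hornerD hornerN E1 E2.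
Qed.

Lemma regular_comp F (c : {lrmorphism A -> A}) : regular F -> regular (fun g => F (c \o g)).
Proof. by move=> h a b e v f r Df; exact: (h (c \o a) b e v f r Df). Qed.

Lemma root_flow0 e v f : root e v -> D e v f = 0 -> root_flow e v (0 *: f) =1 id.
Proof.
move=> r Df a; rewrite root_flowZ // exp_lnd0 //.
exact: (lnd_mull (root_derivation_lnd r) Df).
Qed.

(* Irreducibility of the group: connect two elements by words, and move along
   one one-parameter subgroup at a time. *)
Lemma replica_group_irreducible F1 F2 g1 g2 : regular F1 -> regular F2 ->
  G g1 -> G g2 -> F1 g1 != 0 -> F2 g2 != 0 ->
  exists2 g, G g & F1 g != 0 /\ F2 g != 0.
Proof.
have step (h : {lrmorphism A -> A}) :
  (forall F1 F2, regular F1 -> regular F2 -> F1 idfun != 0 -> F2 h != 0 ->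
     exists2 g, G g & F1 g != 0 /\ F2 g != 0) ->
  forall g, G g -> forall F1 F2, regular F1 -> regular F2 -> F1 g != 0 -> F2 h != 0 ->
     exists2 g, G g & F1 g != 0 /\ F2 g != 0.
  move=> base; apply: replica_group_ind => // e v f psi r Df Gpsi IH {F1 F2}F1 F2 r1 r2 n1 n2.
  (* The leftmost flow is scaled by [t] and also put in front of [h]. Then [p1] is nonzero at $t =
     1$ and [p2] at $t = 0$, so some [t] suits both, and after translation by this flow the
     induction continues with [psi]. *)
  have [p1 E1] := r1 idfun psi _ _ _ r Df.
  have [p2 E2] := r2 idfun h _ _ _ r Df.
  have p10 : p1 != 0.
    apply: contraNneq n1 => p10; have := E1 1.
    by rewrite p10 horner0 scale1r => <-.
  have p20 : p2 != 0.
    apply: contraNneq n2 => p20; have := E2 0.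
    rewrite p20 horner0 => <-; rewrite (_ : _ \o h = h) //.
    by apply/funext => a; rewrite /= root_flow0.
  have [t] := poly_nonroot charK (mulf_neq0 p10 p20).
  rewrite hornerM mulf_eq0 negb_or -E1 -E2 => /andP[t1 t2].
  have [g Gg [h1 h2]] := IH _ _ (regular_comp (root_flow e v (t *: f)) r1)
    (regular_comp (root_flow e v (t *: f)) r2) t1 t2.
  exists (root_flow e v (t *: f) \o g) => //; apply: gen_comp => //.
  by apply: root_flow_replica_group => //; rewrite linearZ /= Df scaler0.
move=> r1 r2 G1 G2 n1 n2; apply: (step g2) n1 n2 => //.
move=> {G1 g1 r1 r2 F1 F2}F1 F2 r1 r2 n1 n2.
(* One element is now the identity; exchanging the roles of the two functions reduces the other to
   the identity as well. *)
have [|g Gg [h1 h2]] := step idfun _ g2 G2 F2 F1 r2 r1 n2 n1; last by exists g.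
by move=> F3 F4 _ _ n3 n4; exists idfun => //; exact: gen_id.
Qed.

(** The property holds on a nonempty principal open subset of the group; by irreducibility any two
    such subsets meet. *)
Definition dense (P : {lrmorphism A -> A} -> Prop) : Prop :=
  exists F, [/\ regular F, exists2 g, G g & F g != 0 &
    forall g, G g -> F g != 0 -> P g].

Lemma denseT : dense (fun=> True).
Proof.
exists (fun=> 1); split=> //; first exact: regular_cst.
by exists idfun; [exact: gen_id|exact: oner_neq0].
Qed.

Lemma dense_sub P Q : (forall g, G g -> P g -> Q g) -> dense P -> dense Q.
Proof. by move=> h [F [rF ex FP]]; exists F; split=> // g Gg /(FP g Gg)/(h g Gg). Qed.

Lemma denseI P Q : dense P -> dense Q -> dense (fun g => P g /\ Q g).
Proof.
move=> [F [rF [g1 G1 n1] FP]] [F' [rF' [g2 G2 n2] FQ]].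
exists (fun g => F g * F' g); split; first exact: regularM.
  have [g Gg [h1 h2]] := replica_group_irreducible rF rF' G1 G2 n1 n2.
  by exists g; rewrite // mulf_neq0.
by move=> g Gg; rewrite mulf_eq0 negb_or => /andP[/(FP g Gg) ? /(FQ g Gg) ?].
Qed.

Lemma dense_all (I : eqType) (s : seq I) (P : I -> {lrmorphism A -> A} -> Prop) :
  (forall i, i \in s -> dense (P i)) -> dense (fun g => forall i, i \in s -> P i g).
Proof.
elim: s => [_|i s IHs h]; first by apply: dense_sub denseT.
have h' j : j \in s -> dense (P j) by move=> js; apply: h; rewrite inE js orbT.
apply: dense_sub (denseI (h i (mem_head _ _)) (IHs h')) => g _ [hi hs] j.
by rewrite inE => /predU1P[->|/hs].
Qed.

Lemma dense_ex P : dense P -> exists2 g, G g & P g.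
Proof. by move=> [F [_ [g Gg gnz] FP]]; exists g => //; exact: FP. Qed.

Lemma dense_neq x y a : (exists2 g, G g & x (g a) != y (g a)) ->
  dense (fun g => x (g a) != y (g a)).
Proof.
move=> [g Gg gnz]; exists (fun g => x (g a) - y (g a)); split.
- by apply: regularB; exact: regular_eval.
- by exists g; rewrite // subr_eq0.
- by move=> h _; rewrite subr_eq0.
Qed.

Lemma dense_neq0 x a : (exists2 g, G g & x (g a) != 0) ->
  dense (fun g => x (g a) != 0).
Proof.
move=> [g Gg gnz]; exists (fun g => x (g a)); split=> //.
  exact: regular_eval.
by exists g.
Qed.

Local Notation toQ := (map_mx (intr : int -> rat)).

Lemma aut_act_comp (g h : {lrmorphism A -> A}) x :
  aut_act (g \o h) x = aut_act h (aut_act g x).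
Proof. exact/kpointP. Qed.

Lemma aut_actK (g h : {lrmorphism A -> A}) x : cancel h g ->
  aut_act h (aut_act g x) = x.
Proof. by move=> gK; apply/kpointP => a; rewrite /= /aut_act /= gK. Qed.

Lemma orbit_of_act x g : G g -> orbit_of G (aut_act g x) = orbit_of G x.
Proof.
move=> Gg; have [h [Gh gK hK]] := replica_group_inv Gg.
rewrite eqEsubset; split=> _ [f Gf ->].
  by exists (g \o f); [exact: gen_comp|rewrite aut_act_comp].
exists (h \o f); first exact: gen_comp.
by rewrite aut_act_comp (aut_actK _ hK).
Qed.

(** Among the weights whose monomial is nonzero somewhere on the orbit, finitely many span all of
    them over the rationals. A point where these finitely many are nonzero is generic, since a
    positive multiple of any other such weight is a difference of two weights in its support. *)
Lemma dense_generic x : dense (fun g => generic (aut_act g x)).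
Proof.
pose P m := exists2 g, G g & x (g (chi m)) != 0.
have [s [sP sspan]] := finite_span (fun m : 'cV[int]_n => toQ m) P.
apply: dense_sub (dense_all (P := fun m (g : {lrmorphism A -> A}) => x (g (chi m)) != 0) _);
  last by move=> m /sP; exact: dense_neq0.
move=> g Gg sn g' Gg' m hm.
have mS : m \in S by exact: (@kpoint_support (aut_act g' (aut_act g x))).
have /sspan ms : P m by exists (g \o g') => //; exact: gen_comp.
set y := aut_act g x.
pose C z := exists a b, [/\ y (chi a) != 0, y (chi b) != 0 & z = a - b].
have supD a b : y (chi a) != 0 -> y (chi b) != 0 -> y (chi (a + b)) != 0.
  by move=> ha hb; rewrite kpoint_chiD ?mulf_neq0 ?(kpoint_support ha) ?(kpoint_support hb).
have sup0 : y (chi 0) != 0 by rewrite kpoint_chi0 oner_neq0.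
have C0 : C 0 by exists 0, 0; rewrite subr0.
have CD u w : C u -> C w -> C (u + w).
  move=> [a [b [ha hb ->]]] [a' [b' [ha' hb' ->]]].
  by exists (a + a'), (b + b'); split; [exact: supD|exact: supD|rewrite opprD addrACA].
have CN u : C u -> C (- u).
  by move=> [a [b [ha hb ->]]]; exists b, a; rewrite opprB.
have Cs u : u \in s -> C u.
  by move=> us; exists u, 0; split; rewrite ?subr0 //; exact: sn.
have [N [_ [N0 [a [b [ha hb ->]]] E]]] := span_integral C0 CD CN Cs ms.
case: N N0 E => // N N0; rewrite -map_mxZ => /toQ_inj E.
have {}E : m *+ N + b = a by rewrite -scaler_nat natz E subrK.
(* Here $\chi^m(y)^N \chi^b(y) = \chi^a(y) \neq 0$, which forces $\chi^m(y) \neq 0$. *)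
apply: contraNneq ha => ym; rewrite -E kpoint_chiD ?rpredMn //; last exact: kpoint_support hb.
by rewrite kpoint_chiMn // ym; case: (N) N0 => // k _; rewrite exprS !mul0r.
Qed.

Lemma generic_orbit_support x g0 g m : G g0 -> generic (aut_act g0 x) -> G g ->
  x (g (chi m)) != 0 -> x (g0 (chi m)) != 0.
Proof.
move=> G0 gx Gg; have [h [Gh gK hK]] := replica_group_inv G0.
have Ghg : G (h \o g) by exact: gen_comp.
by move=> xg; apply: (gx _ Ghg); rewrite /= /aut_act /= hK.
Qed.

Lemma active_sub x y e : (forall m, x (chi m) != 0 -> y (chi m) != 0) ->
  active x e -> active y e.
Proof. by move=> h [b h1 h2]; exists b; exact: h. Qed.

Lemma generic_orbit_active x g0 g e : G g0 -> generic (aut_act g0 x) -> G g ->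
  active (aut_act g x) e -> active (aut_act g0 x) e.
Proof.
by move=> G0 gx Gg; apply: active_sub => m; exact: generic_orbit_support.
Qed.

(** An inactive flow fixes [x], and an active one multiplies both monomials by the same factor. That
    factor may vanish, and then the moved point need not have the same support; so the identity is
    proved for the coefficient $tf$ with the factor nonzero, and reaches $t = 1$ as a polynomial
    identity in $t$. *)
Lemma invariant_character x a b : generic x ->
  (forall e v, root e v -> active x e -> height v a = height v b) ->
  a \in S -> b \in S ->
  forall g, G g -> x (g (chi a)) * x (chi b) = x (g (chi b)) * x (chi a).
Proof.
move=> gx hab hS hS' g Gg; elim/replica_group_ind: Gg x gx hab.
  by move=> x _ _; rewrite mulrC.
move=> e v f psi r Df Gpsi IH x gx hab.
have [act|nact] := pselect (active x e); last first.
  by rewrite /= !(flow_inactive _ gx r Df nact); apply: IH.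
have [c xc xce] := act.
have [pa Ea] := root_flow_poly x (psi (chi a)) r Df.
have [pb Eb] := root_flow_poly x (psi (chi b)) r Df.
pose p := pa * (x (chi b))%:P - pb * (x (chi a))%:P.
pose q := (x f * slope x c e) *: 'X + 1%:P : {poly K}.
have q0 : q != 0.
  apply: contra_neq (oner_neq0 K) => q0; have : q.[0] = 1 by rewrite !hornerE.
  by rewrite q0 horner0.
have : p = 0.
  apply: (poly_eq0_generic charK q0) => t.
  rewrite /q hornerD hornerZ hornerX hornerC (mulrAC (x f) (slope x c e) t) => qt.
  have Dt : D e v (t *: f) = 0 by rewrite linearZ /= Df scaler0.
  pose y := aut_act (root_flow e v (t *: f)) x.
  have yE m : m \in S -> y (chi m) = x (chi m) * (x f * t * slope x c e + 1) ^+ height v m.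
    by move=> hm; rewrite [LHS](flow_active r Dt xc xce hm) linearZ /= [t *: _]mulrC.
  have sup m : (y (chi m) != 0) = (x (chi m) != 0).
    have [hm|hm] := boolP (m \in S); last by rewrite !chi_out // !raddf0.
    by rewrite yE // mulf_eq0 expf_eq0 (negPf qt) andbF orbF.
  have gy : generic y.
    by apply: generic_act (root_flow_replica_group r Dt) _ => // m; rewrite -sup.
  have /(IH y gy) : forall e v, root e v -> active y e -> height v a = height v b.
    move=> e' v' r' [b' h1 h2]; apply: hab r' _.
    by exists b'; rewrite -sup.
  rewrite !yE // (hab e v r act).
  set c1 := _ ^+ _; have c10 : c1 != 0 by rewrite expf_neq0.
  rewrite (mulrA _ _ c1) (mulrA _ _ c1) => /(mulIf c10).
  by rewrite /p !hornerE -Ea -Eb => ->; rewrite subrr.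
move/(congr1 (horner^~ 1)); rewrite !hornerE -Ea -Eb scale1r => /eqP.
by rewrite subr_eq0 => /eqP.
Qed.

(* If the conclusion failed, all monomials of height [0] would be constant on
   the orbit, and a point of the orbit would be determined by the value of one
   monomial of height [1]; so the orbit would be at most a curve. *)
Lemma transverse_root x e v : generic x -> dim_ge (orbit_of G x) 2 ->
  root e v -> active x e ->
  exists e2 v2 w, [/\ root e2 v2, active x e2, height v w = 0%N, x (chi w) != 0 &
    height v2 w != 0%N].
Proof.
move=> gx [Z [Zirr Zlt]] r [c xc xce]; apply: contrapT => nex.
have cS := kpoint_support xc; have ceS := kpoint_support xce.
have inv w z : orbit_of G x z -> w \in S -> height v w = 0%N -> z (chi w) = x (chi w).
  move=> [g Gg ->] wS hw; have [xw|xw] := eqVneq (x (chi w)) 0.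
    by rewrite xw; apply/eqP; apply: contraT => /(gx g Gg); rewrite xw eqxx.
  have := @invariant_character x w 0 gx _ wS (rpred0 _) g Gg.
  rewrite !kpoint_chi0 chi0 rmorph1 rmorph1 mulr1 mul1r; apply=> e' v' r' act'.
  rewrite /height pairing0r; apply/eqP; apply: contrapT => /negP h.
  by apply: nex; exists e', v', w; split.
(* Since [c + e] has nonnegative height, [c] has height at least 1; shifting by [e] one time fewer
   than its height gives the weight [b] of height 1. *)
have hc : (height v c).-1.+1 = height v c.
  have [ve _ _] := demazure_rootP sigma_poly sigma_convex r.
  rewrite prednK // -ltz_nat -(heightE r) // -[c](addrK e) pairingDr pairingNr ve.
  by rewrite (heightE r) // opprK ltzD1.
have lec : ((height v c).-1 <= height v c)%N by rewrite -{2}hc.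
have [bS hb] := root_shift r cS lec.
have xb : x (chi (c + e *+ (height v c).-1)) != 0.
  by rewrite (kpoint_shift r xc xce) // mulf_neq0 ?expf_neq0 ?slope_neq0.
have xbe : x (chi (c + e *+ (height v c).-1 + e)) != 0.
  rewrite -addrA -mulrSr hc (kpoint_shift r xc xce) //.
  by rewrite mulf_neq0 ?expf_neq0 ?slope_neq0.
move: bS hb xb xbe; set b := c + _ => bS hb xb xbe {lec}.
have {}hb : height v b = 1%N by rewrite hb -{1}hc subSn // subnn.
have [_ hbe] : b + e *+ 1 \in S /\ height v (b + e *+ 1) = 0%N.
  by have := @root_shift e v b 1 r bS; rewrite hb => /(_ isT).
have beS := kpoint_support xbe.
set k := x (chi (b + e)) in xbe.
have orbk z : orbit_of G x z -> z (chi (b + e)) = k by move=> oz; apply: inv.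
(* With $h$ the height of $m$, $\chi^m (\chi^{b+e})^h = \chi^{m+he} (\chi^b)^h$, where $\chi^{b+e}$
   and $\chi^{m+he}$ have height zero and are constant on the orbit. *)
have param a : exists p : {poly K}, forall z, orbit_of G x z -> z a = p.[z (chi b)].
  elim/chi_ind: a => [|t a1 a2 [p1 E1] [p2 E2]|m mS].
  - by exists 0 => z _; rewrite horner0 raddf0.
  - exists (t *: p1 + p2) => z oz.
    by rewrite linearP hornerD hornerZ -E1 // -E2.
  have [mhS mh0] := root_shift r mS (leqnn (height v m)); rewrite subnn in mh0.
  exists ((x (chi (m + e *+ height v m)) / k ^+ height v m) *: 'X^(height v m)) => z oz.
  rewrite hornerZ hornerXn mulrAC; apply: (canRL (mulfK (expf_neq0 _ xbe))).
  rewrite -(inv _ z oz mhS mh0) -{1}(orbk z oz) -!kpoint_chiMn //.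
  by rewrite -!kpoint_chiD ?rpredMn // mulrnDl addrA addrAC.
have inj z z' : orbit_of G x z -> orbit_of G x z' -> z (chi b) = z' (chi b) -> z = z'.
  move=> oz oz' E; apply: kpoint_ext => m _.
  by have [p Ep] := param (chi m); rewrite !Ep // E.
have [irr0 cl0] := Zirr 0%N isT; have [irr1 cl1] := Zirr 1%N isT.
have [irr2 cl2] := Zirr 2%N isT.
have sub0 := Zlt 0%N isT; have sub1 := Zlt 1%N isT.
have orb i : (i <= 2)%N -> Z i `<=` orbit_of G x.
  by move=> /Zirr[_ [C _ ->]]; exact: subIsetl.
have [[p0 Zp0] _] := irr0.
have [p1 Zp1 nZp1] : exists2 z, Z 1%N z & ~ Z 0%N z.
  by apply: contrapT => h; apply: sub0.2 => z hz; apply: contrapT => h'; apply: h; exists z.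
have [p2 Zp2 nZp2] : exists2 z, Z 2%N z & ~ Z 1%N z.
  by apply: contrapT => h; apply: sub1.2 => z hz; apply: contrapT => h'; apply: h; exists z.
have o0 := orb 0%N isT _ Zp0; have o1 := orb 1%N isT _ Zp1; have o2 := orb 2%N isT _ Zp2.
(* A function vanishing on [Z 1] but not at [p2] is a nonzero polynomial in $\chi^b$. Splitting off
   its zero at [p0] covers [Z 1] by two closed sets. By irreducibility one contains [Z 1], so that
   either [p1] equals [p0] or [p0] gives a root of [q]; both are excluded. *)
have [C1 [I C1E] Z1E] := cl1.
have [f If p2f] : exists2 f, I f & p2 f != 0.
  apply: contrapT => h; apply: nZp2; rewrite Z1E C1E; split=> // f If.
  by apply/eqP; apply: contrapT => /negP h'; apply: h; exists f.
have [p Ep] := param f.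
have pn0 : p != 0 by apply: contraNneq p2f => p0'; rewrite Ep // p0' horner0.
have [q qs0 pE] : exists2 q, ~~ poly.root q (p0 (chi b)) &
    exists i, p = q * ('X - (p0 (chi b))%:P) ^+ i.
  have [i [q /implyP/(_ pn0) h1 h2]] := multiplicity_XsubC p (p0 (chi b)).
  by exists q => //; exists i.
pose fq := \sum_(i < size q) q`_i *: chi b ^+ i.
have fqE (z : kpoint A) : z fq = q.[z (chi b)].
  rewrite /fq raddf_sum horner_coef; apply: eq_bigr => i _ /=.
  by rewrite kpointZ rmorphXn.
pose fl := chi b - (p0 (chi b))%:A.
have flE (z : kpoint A) : z fl = z (chi b) - p0 (chi b).
  by rewrite raddfB /= kpoint_alg.
pose V (g : A) : set (kpoint A) := [set z : kpoint A | forall h, [set g] h -> z h = 0].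
have VP g : zariski_closed (V g) by exists [set g].
have cov : Z 1%N `<=` V fl `|` V fq.
  move=> z; rewrite {1}Z1E C1E => -[oz /(_ f If)]; rewrite Ep //.
  have [i ->] := pE; rewrite hornerM horner_exp hornerXsubC => /eqP.
  rewrite mulf_eq0 expf_eq0 orbC => /orP[/andP[_ /eqP h]|/eqP h]; [left|right] => _ ->.
    by rewrite flE.
  by rewrite fqE.
case: (irr1.2 _ _ (VP fl) (VP fq) cov) => sub.
  apply: nZp1; rewrite (inj p1 p0) //; apply/eqP; rewrite -subr_eq0 -flE; apply/eqP.
  exact: sub p1 Zp1 fl erefl.
by move/negP: qs0; apply; apply/eqP; rewrite -fqE; apply: (sub p0) => //; exact: sub0.1.
Qed.

(* The functions invariant under the root subgroups with ray [v] separate [x]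
   from [y]. *)
Definition separated v x y : Prop :=
  exists w, [/\ w \in S, height v w = 0%N & x (chi w) != y (chi w)].

(** One separating [g] suffices. If none exists, all monomials of [v]-height zero agree at two
    generic translates and at their common images. Moving both along the flows of
    $t\chi^a\partial_{e_2}$, for a root $e_2$ transverse to [v], then shows that the translates
    coincide. *)
Lemma dense_separated x y e v g0 : x <> y -> dim_ge (orbit_of G x) 2 ->
  root e v -> G g0 -> generic (aut_act g0 x) -> active (aut_act g0 x) e ->
  dense (fun g => separated v (aut_act g x) (aut_act g y)).
Proof.
move=> nxy dimx r Gg0 gx0 act0.
suff [g [Gg [w [wS hw nw]]]] : exists g, G g /\ separated v (aut_act g x) (aut_act g y).
  have : exists2 g, G g & x (g (chi w)) != y (g (chi w)) by exists g.
  by move/dense_neq; apply: dense_sub => h _ nh; exists w.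
have [g1 Gg1 [gy1 gy2]] := dense_ex (denseI (dense_generic x) (dense_generic y)).
have [g1' [Gg1' g1K g1'K]] := replica_group_inv Gg1.
set y1 := aut_act g1 x in gy1; set y2 := aut_act g1 y in gy2.
have ny : y1 <> y2.
  by move=> E; apply: nxy; rewrite -(aut_actK x g1'K) -(aut_actK y g1'K) -/y1 -/y2 E.
apply: contrapT => nex.
have same h w : G h -> w \in S -> height v w = 0%N -> y1 (h (chi w)) = y2 (h (chi w)).
  move=> Gh wS hw; apply/eqP; apply: contrapT => /negP nw; apply: nex.
  by exists (g1 \o h); split; [exact: gen_comp|exists w].
have act1 : active y1 e by apply: generic_orbit_active act0.
have dim1 : dim_ge (orbit_of G y1) 2 by rewrite orbit_of_act.
have [e2 [v2 [w [r2 act2 hw y1w hw2]]]] := transverse_root gy1 dim1 r act1.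
have wS := kpoint_support y1w.
have y12w : y2 (chi w) = y1 (chi w) by rewrite (same idfun w) //; exact: gen_id.
have [b1 b1n b1en] := act2; set th1 := slope y1 b1 e2.
have th1n : th1 != 0 by exact: slope_neq0.
have Dchi0 a : a \in S -> height v2 a = 0%N -> D e2 v2 (chi a) = 0.
  by move=> aS ha; rewrite D_chi // (heightE r2) // ha scale0r.
have D0 (t : K) a : a \in S -> height v2 a = 0%N -> D e2 v2 (t *: chi a) = 0.
  by move=> aS ha; rewrite linearZ /= Dchi0 // scaler0.
have val0 : height v2 0 = 0%N by rewrite /height pairing0r.
have act22 : active y2 e2.
  (* Otherwise the flow with coefficient [- th1^-1] would make $\chi^w$ vanish at [y1] while fixing
     [y2], where it is nonzero. *)
  apply: contrapT => nact.
  have Dt : D e2 v2 (- th1^-1 *: chi 0) = 0 by apply: D0 => //; exact: rpred0.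
  have := same _ w (root_flow_replica_group r2 Dt) wS hw.
  rewrite (flow_active r2 Dt b1n b1en wS) (flow_inactive _ gy2 r2 Dt nact) y12w.
  rewrite kpointZ kpoint_chi0 mulr1 -/th1 mulNr mulVf // addNr.
  by rewrite expr0n (negPf hw2) mulr0 => /eqP; rewrite eq_sym (negPf y1w).
have [b2 b2n b2en] := act22; set th2 := slope y2 b2 e2.
have th2n : th2 != 0 by exact: slope_neq0.
have key a : a \in S -> height v2 a = 0%N -> y1 (chi a) * th1 = y2 (chi a) * th2.
  move=> aS ha.
  (* Only equal powers of the two factors are known; comparing the [t] at which they vanish avoids
     extracting roots. *)
  have E (t : K) : (t * (y1 (chi a) * th1) + 1 == 0) = (t * (y2 (chi a) * th2) + 1 == 0).
    have Dt := D0 t a aS ha.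
    have := same _ w (root_flow_replica_group r2 Dt) wS hw.
    rewrite (flow_active r2 Dt b1n b1en wS) (flow_active r2 Dt b2n b2en wS) y12w.
    rewrite -/th1 -/th2 !kpointZ => /(mulfI y1w).
    move=> /(congr1 (fun u => u == 0)); rewrite !expf_eq0 lt0n hw2 /=.
    by rewrite !mulrA.
  have [z1|n1] := eqVneq (y1 (chi a) * th1) 0.
    rewrite z1; apply/esym/eqP; apply: contrapT => /negP n2.
    have := E (- (y2 (chi a) * th2)^-1).
    by rewrite z1 mulr0 add0r oner_eq0 mulNr mulVf // addNr eqxx.
  have := E (- (y1 (chi a) * th1)^-1); rewrite !mulNr mulVf // addNr eqxx => /esym/eqP.
  move/(congr1 ( *%R (y1 (chi a) * th1))).
  by rewrite mulrDr mulrN mulVKf // mulr1 mulr0 addrC => /subr0_eq.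
have th12 : th1 = th2.
  by have := key 0 (rpred0 _) val0; rewrite !kpoint_chi0 !mul1r.
apply: ny; apply: kpoint_ext => m mS.
(* Shifting [m] down to [v2]-height zero makes [key] applicable; the equal nonzero slopes then
   cancel. *)
have [mkS mk0] := root_shift r2 mS (leqnn (height v2 m)); rewrite subnn in mk0.
have := key _ mkS mk0; rewrite -th12 => /(mulIf th1n).
rewrite (kpoint_shift r2 b1n b1en) // (kpoint_shift r2 b2n b2en) //.
by rewrite -/th1 -/th2 -th12 => /(mulIf (expf_neq0 _ th1n)).
Qed.

(** * Moving one point and fixing others *)

(** Value of $\chi^m$ at the torus element $\prod v(\lambda)$; the root is kept next to [v] to name
    the flow realizing each factor. *)
Definition torus_factor (t : seq (('cV[int]_n * 'rV[int]_n) * K)) m : K :=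
  \prod_(p <- t) p.2 ^+ height p.1.2 m.

(** The quotients $\chi^m(gz)/\chi^m(z)$ define a character on the group generated by the support of
    [z]. By [invariant_character] it is trivial where all active [v] vanish, so
    [character_extension] applies. *)
Lemma generic_torus_translate z g (s : seq ('cV[int]_n * 'rV[int]_n)) :
  generic z -> G g -> generic (aut_act g z) ->
  (forall p, p \in s -> root p.1 p.2) ->
  (forall e v, root e v -> active z e -> toQ v \in <<[seq toQ p.2 | p <- s]>>%VS) ->
  exists t, [/\ map fst t = s, all (fun p => p.2 != 0) t &
    forall m, m \in S -> z (g (chi m)) = z (chi m) * torus_factor t m].
Proof.
move=> gz Gg gz' rs hspan.
pose rho m := z (g (chi m)) / z (chi m).
have gn m : z (chi m) != 0 -> z (g (chi m)) != 0 by exact: generic_support.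
have rhon m : z (chi m) != 0 -> rho m != 0.
  by move=> zm; rewrite mulf_neq0 ?invr_neq0 ?gn.
have supD a b : z (chi a) != 0 -> z (chi b) != 0 -> z (chi (a + b)) != 0.
  by move=> ha hb; rewrite kpoint_chiD ?mulf_neq0 ?(kpoint_support ha) ?(kpoint_support hb).
have rhoD a b : z (chi a) != 0 -> z (chi b) != 0 -> rho (a + b) = rho a * rho b.
  move=> ha hb; have aS := kpoint_support ha; have bS := kpoint_support hb.
  by rewrite /rho chiD // !rmorphM invfM mulrACA.
pose rep u (p : 'cV[int]_n * 'cV[int]_n) :=
  [/\ z (chi p.1) != 0, z (chi p.2) != 0 & u = p.1 - p.2].
pose L u := exists p, rep u p.
(* A representation of [u] as a difference is chosen; [rE] shows that the choice is immaterial. The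
   default 1 concerns only [u] outside [L]. *)
pose r u : K := if pselect (L u) is left ex then
  rho (projT1 (cid ex)).1 / rho (projT1 (cid ex)).2 else 1.
have rE u a b : z (chi a) != 0 -> z (chi b) != 0 -> u = a - b -> r u = rho a / rho b.
  move=> ha hb uE; rewrite /r; case: pselect => [ex|[]]; last by exists (a, b).
  case: (cid ex) => -[c d] [/= hc hd]; rewrite uE => E.
  apply/eqP; rewrite eqr_div ?rhon //; apply/eqP.
  rewrite -!rhoD //; congr (rho _).
  by rewrite -[c](subrK d) -E addrAC subrK.
have hr : subgroup_character L r.
  split.
  - by exists (0, 0); split; rewrite ?kpoint_chi0 ?oner_neq0 ?subr0.
  - move=> _ _ [[a b] [/= ha hb ->]] [[c d] [/= hc hd ->]].
    exists (a + d, b + c); split; [exact: supD|exact: supD|].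
    by rewrite /= opprB opprD addrACA.
  - move=> u [[a b] [/= ha hb uE]]; rewrite (rE u a b) //.
    by rewrite mulf_neq0 ?invr_neq0 ?rhon.
  move=> u w [[a b] [/= ha hb uE]] [[c d] [/= hc hd wE]].
  rewrite (rE u a b) // (rE w c d) // (rE (u + w) (a + c) (b + d)) ?supD //.
    by rewrite !rhoD // invfM mulrACA.
  by rewrite uE wE opprD addrACA.
have [|t [tE t0 rt]] := character_extension (v := fun p => p.2) (s := s) hr.
  move=> u [[a b] [/= ha hb uE]] h; rewrite (rE u a b) //.
  suff E : rho a = rho b by rewrite E divff ?rhon.
  have aS := kpoint_support ha; have bS := kpoint_support hb.
  apply/eqP; rewrite eqr_div // mulrC eq_sym mulrC eq_sym; apply/eqP.
  apply: invariant_character => // e v re ae.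
  suff : pairing v u = 0.
    by rewrite uE pairingDr pairingNr (heightE re) // (heightE re) // => /subr0_eq [].
  apply/eqP; rewrite -(@intr_eq0 rat) -pairing_map; apply/eqP.
  have := hspan e v re ae; have : forall w, w \in [seq toQ p.2 | p <- s] ->
      pairing w (toQ u : 'cV[rat]_n) = 0.
    by move=> _ /mapP[p ps ->]; rewrite pairing_map h.
  elim: [seq toQ p.2 | p <- s] (toQ v) => [|w l IHl] w' hl.
    by rewrite span_nil memv0 => /eqP->; rewrite pairing0l.
  rewrite span_cons => /memv_addP[_ /vlineP[c ->] [w2 hw2 ->]].
  rewrite pairingDl pairingZl hl ?inE ?eqxx // mulr0 add0r IHl //.
  by move=> w3 hw3; apply: hl; rewrite inE hw3 orbT.
exists t; split=> // m mS; have [zm|zm] := eqVneq (z (chi m)) 0.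
  by rewrite zm mul0r; apply/eqP; apply: contraT => /(gz g Gg); rewrite zm eqxx.
have z0 : z (chi 0) != 0 by rewrite kpoint_chi0 oner_neq0.
have : r m = rho m.
  rewrite (rE m m 0) ?subr0 //.
  by rewrite /rho kpoint_chi0 chi0 !rmorph1 !divr1.
rewrite rt; last by exists (m, 0); rewrite /rep subr0.
move=> E; apply/eqP; rewrite mulrC -(divfK zm (z (g (chi m)))) -/(rho m) -E; apply/eqP.
congr (_ * _); rewrite /torus_factor; apply: eq_big_seq => p pt.
by rewrite (heightE (rs p.1 _)) // -tE map_f.
Qed.

(** The product of the $\chi^{w_j} - \chi^{w_j}(y_j)$ lies in the kernel of the derivation, vanishes
    at every $y_j$ and is nonzero at [z]. *)
Lemma separated_move (J : finType) (y : J -> kpoint A) z e v (c : K) :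
  root e v -> active z e -> (forall j, separated v z (y j)) -> c != 0 ->
  exists g, [/\ G g, forall m, m \in S -> z (g (chi m)) = z (chi m) * c ^+ height v m &
    forall j, aut_act g (y j) = y j].
Proof.
move=> r [b zb zbe] sep c0.
have [w hw] : exists w : J -> 'cV[int]_n, forall j,
    [/\ w j \in S, height v (w j) = 0%N & z (chi (w j)) != y j (chi (w j))].
  by exists (fun j => projT1 (cid (sep j))) => j; exact: (projT2 (cid (sep j))).
pose f0 := \prod_j (chi (w j) - (y j (chi (w j)))%:A).
have hD := root_derivation_lnd r.
have Df0 : D e v f0 = 0.
  apply: (big_ind (fun a => D e v a = 0)) => [|a a' ha ha'|j _]; first exact: lnd1.
    by rewrite (lndM hD) ha ha' mul0r mulr0 addr0.
  have [wS wh _] := hw j.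
  by rewrite linearB linearZ /= (lnd1 hD) scaler0 subr0 D_chi // (heightE r) // wh scale0r.
have zf0 : z f0 != 0.
  rewrite rmorph_prod; apply/prodf_neq0 => j _; have [_ _ nw] := hw j.
  by rewrite raddfB /= kpoint_alg subr_eq0.
have yf0 j : y j f0 = 0.
  by rewrite rmorph_prod (bigD1 j) //= raddfB /= kpoint_alg subrr mul0r.
(* Solves $1 + k f_0(z)\chi^e(z) = c$. *)
pose k := (c - 1) / (z f0 * slope z b e).
have kn : z f0 * slope z b e != 0 by rewrite mulf_neq0 ?slope_neq0.
have Df : D e v (k *: f0) = 0 by rewrite linearZ /= Df0 scaler0.
exists (root_flow e v (k *: f0)); split; first exact: root_flow_replica_group.
  move=> m mS; rewrite (flow_active r Df zb zbe mS) kpointZ.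
  by rewrite -mulrA /k divfK // subrK.
move=> j; apply: kpoint_ext => m mS.
by apply: (flow_kernel r Df mS); rewrite kpointZ yf0 mulr0.
Qed.

(** * Paths of torus translates avoiding finitely many points *)

Definition cofinite (P : K -> Prop) : Prop :=
  exists2 p : {poly K}, p != 0 & forall t, p.[t] != 0 -> P t.

Lemma cofiniteI P Q : cofinite P -> cofinite Q -> cofinite (fun t => P t /\ Q t).
Proof.
move=> [p p0 hp] [q q0 hq]; exists (p * q); first by rewrite mulf_neq0.
by move=> t; rewrite hornerM mulf_eq0 negb_or => /andP[/hp ? /hq ?].
Qed.

Lemma cofinite_all (I : eqType) (s : seq I) (P : I -> K -> Prop) :
  (forall i, i \in s -> cofinite (P i)) ->
  cofinite (fun t => forall i, i \in s -> P i t).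
Proof.
elim: s => [_|i s IHs h]; first by exists 1; rewrite ?oner_neq0.
have h' j : j \in s -> cofinite (P j) by move=> js; apply: h; rewrite inE js orbT.
have [p p0 hp] := cofiniteI (h i (mem_head _ _)) (IHs h').
by exists p => // t /hp[hi hs] j; rewrite inE => /predU1P[->|/hs].
Qed.

(** A weight separating [z] from [y j] keeps doing so: the difference of values is a polynomial in
    [t], nonzero at $t = c$, where $z'$ is [z]. *)
Lemma cofinite_separated (J : finType) (y : J -> kpoint A) z v v' (c : K) : c != 0 ->
  (forall j, separated v' z (y j)) ->
  cofinite (fun t => forall (z' : kpoint A),
    (forall m, m \in S -> z' (chi m) = z (chi m) * (t / c) ^+ height v m) ->
    forall j, separated v' z' (y j)).
Proof.
move=> c0 sep.
suff : cofinite (fun t => forall j, j \in enum J -> forall (z' : kpoint A),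
    (forall m, m \in S -> z' (chi m) = z (chi m) * (t / c) ^+ height v m) ->
    separated v' z' (y j)).
  by case=> p p0 hp; exists p => // t /hp h z' hz' j; apply: h => //; rewrite mem_enum.
apply: cofinite_all => j _; have [w [wS wh nw]] := sep j.
exists ((z (chi w) / c ^+ height v w) *: 'X^(height v w) - (y j (chi w))%:P).
  apply: contraNneq nw => p0; have : ((0 : {poly K}).[c] = 0) by rewrite horner0.
  rewrite -p0 hornerD hornerN hornerZ hornerXn hornerC divfK ?expf_neq0 //.
  by move/subr0_eq->.
move=> t; rewrite hornerD hornerN hornerZ hornerXn hornerC subr_eq0 => ht z' hz'.
by exists w; split=> //; rewrite hz' // expr_div_n mulrA mulrAC.
Qed.

(** Lying in one orbit of the pointwise stabilizer of the [y j]. *)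
Definition linked (J : Type) (y : J -> kpoint A) x x' : Prop :=
  exists2 g, G g & aut_act g x = x' /\ forall j, aut_act g (y j) = y j.

Lemma linked_trans J (y : J -> kpoint A) x1 x2 x3 :
  linked y x1 x2 -> linked y x2 x3 -> linked y x1 x3.
Proof.
move=> [g Gg [<- hg]] [h Gh [<- hh]]; exists (g \o h); first exact: gen_comp.
by split=> [|j]; rewrite aut_act_comp // hg.
Qed.

Lemma linked_sym J (y : J -> kpoint A) x1 x2 : linked y x1 x2 -> linked y x2 x1.
Proof.
move=> [g Gg [<- hg]]; have [h [Gh gK hK]] := replica_group_inv Gg.
by exists h => //; split=> [|j]; rewrite -1?[in LHS]hg aut_actK.
Qed.

(** Moving [z] directly by $v(c)$ could destroy the separation needed for later factors. Instead [z]
    is moved by $v(u)$ and [z'] by $v(u/c)$, after which they differ by the tail of [t]. Separation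
    of the first holds at $u = 1$ and of the second at $u = c$, hence of both for general [u]. *)
Lemma torus_linked (J : finType) (y : J -> kpoint A) t z z' :
  (forall p, p \in t -> [/\ root p.1.1 p.1.2, p.2 != 0, active z p.1.1 &
     forall j, separated p.1.2 z (y j) /\ separated p.1.2 z' (y j)]) ->
  (forall m, m \in S -> z' (chi m) = z (chi m) * torus_factor t m) ->
  linked y z z'.
Proof.
elim: t z z' => [|[[e v] c] t IHt] z z' ht zE.
  have -> : z' = z.
    by apply: kpoint_ext => m /zE; rewrite /torus_factor big_nil mulr1.
  exists idfun; first exact: gen_id.
  by split=> [|j]; apply/kpointP.
have [/= r c0 az sep] := ht ((e, v), c) (mem_head _ _).
have ht' p : p \in t -> _ := fun pt => ht p (mem_behead (s := _ :: t) pt).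
have fac0 m : torus_factor t m != 0.
  rewrite /torus_factor; elim: (t) ht' => [|p l IHl] hl; first by rewrite big_nil oner_neq0.
  rewrite big_cons mulf_neq0 ?IHl //; last by move=> q ql; apply: hl; rewrite inE ql orbT.
  by have [_ p0 _ _] := hl p (mem_head _ _); rewrite expf_neq0.
have az' : active z' e.
  apply: active_sub az => m zm; rewrite zE ?(kpoint_support zm) //.
  rewrite mulf_neq0 // /torus_factor big_cons mulf_neq0 ?fac0 ?expf_neq0 //.
have cof : cofinite (fun u => forall p, p \in t ->
    (forall z1 : kpoint A,
       (forall m, m \in S -> z1 (chi m) = z (chi m) * (u / 1) ^+ height v m) ->
       forall j, separated p.1.2 z1 (y j)) /\
    (forall z1 : kpoint A,
       (forall m, m \in S -> z1 (chi m) = z' (chi m) * (u / c) ^+ height v m) ->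
       forall j, separated p.1.2 z1 (y j))).
  apply: cofinite_all => p pt; have [_ _ _ sp] := ht' p pt.
  apply: cofiniteI; apply: cofinite_separated; rewrite ?oner_neq0 //.
    by move=> j; have [] := sp j.
  by move=> j; have [] := sp j.
have [p p0 hp] := cof.
(* The extra factor ['X] makes [u] nonzero. *)
have [u] := poly_nonroot charK (mulf_neq0 p0 (negbT (polyX_eq0 K))).
rewrite hornerM hornerX mulf_eq0 negb_or => /andP[/hp hu u0].
have [|g [Gg gE gy]] := @separated_move J y z e v u r az _ u0.
  by move=> j; have [] := sep j.
have uc : u / c != 0 by rewrite mulf_neq0 ?invr_neq0.
have [|g' [Gg' gE' gy']] := @separated_move J y z' e v (u / c) r az' _ uc.
  by move=> j; have [] := sep j.
apply: linked_trans (_ : linked y z (aut_act g z)) _; first by exists g.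
apply: linked_trans (linked_sym (_ : linked y z' (aut_act g' z'))); last by exists g'.
apply: IHt => [q qt|m mS].
  have [rq q0 aq sq] := ht' q qt; split=> //.
    apply: active_sub aq => m zm; have mS := kpoint_support zm.
    by rewrite [X in X != 0]gE // mulf_neq0 ?expf_neq0.
  have [h1 h2] := hu q qt.
  by move=> j; split; [apply: h1 => m mS; rewrite divr1; exact: gE|apply: h2].
rewrite [LHS]gE' // [X in _ = X * _]gE // zE // /torus_factor big_cons /=.
rewrite expr_div_n -!mulrA; congr (_ * _).
by rewrite mulrC -!mulrA mulVf ?expf_neq0 // mulr1 mulrC.
Qed.

(** Everything is translated by one general [h] that makes [x] and [x'] generic and separated from
    all [y j] along the chosen rays; the path given by [torus_linked] is then conjugated back. *)
Lemma orbit_linked (J : finType) (y : J -> kpoint A) x x' :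
  dim_ge (orbit_of G x) 2 -> orbit_of G x x' ->
  (forall j, x <> y j) -> (forall j, x' <> y j) -> linked y x x'.
Proof.
move=> dimx [g Gg x'E] nx nx'.
(* All generic points of an orbit have the same active roots, so those at this reference point serve
   for the translate by [h] chosen later. *)
have [g0 Gg0 gx0] := dense_ex (dense_generic x).
have [s [sP sspan]] := finite_span (fun p : 'cV[int]_n * 'rV[int]_n => toQ p.2)
  (fun p => root p.1 p.2 /\ active (aut_act g0 x) p.1).
have dimx' : dim_ge (orbit_of G x') 2 by rewrite x'E orbit_of_act.
have [g' [Gg' gK g'K]] := replica_group_inv Gg.
have xE : x = aut_act g' x' by rewrite x'E aut_actK.
have dsep p j : p \in s -> dense (fun h =>
    separated p.2 (aut_act h x) (aut_act h (y j)) /\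
    separated p.2 (aut_act h x') (aut_act h (y j))).
  move=> /sP[rp ap]; apply: denseI.
    exact: (dense_separated (nx j) dimx rp Gg0 gx0 ap).
  have E : aut_act (g' \o g0) x' = aut_act g0 x by rewrite aut_act_comp -xE.
  apply: (@dense_separated _ _ p.1 p.2 (g' \o g0)) => //; rewrite ?E //.
  exact: gen_comp.
have [h Gh [[hx hx'] hsep]] := dense_ex (denseI (denseI (dense_generic x) (dense_generic x'))
  (dense_all (s := s) (fun p ps => dense_all (s := enum J) (fun j _ => dsep p j ps)))).
have [h' [Gh' hK h'K]] := replica_group_inv Gh.
set z := aut_act h x in hx; set z' := aut_act h x' in hx'.
have z'E : z' = aut_act (h' \o (g \o h)) z.
  by rewrite !aut_act_comp /z (aut_actK x h'K) /z' x'E.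
have Gk : G (h' \o (g \o h)) by apply: gen_comp => //; exact: gen_comp.
have [|||t [tE t0 zt]] := @generic_torus_translate z _ s hx Gk.
- by rewrite -z'E.
- by move=> p /sP[].
- move=> e v r az; apply: (sspan (e, v)); split=> //=.
  exact: generic_orbit_active az.
have : linked (fun j => aut_act h (y j)) z z'.
  apply: (@torus_linked _ _ t) => [p pt|m mS]; last by rewrite z'E; exact: zt.
  have ps : p.1 \in s by rewrite -tE map_f.
  have [rp ap] := sP _ ps; split=> //.
  - exact: (allP t0).
  - exact: generic_orbit_active ap.
  - by move=> j; apply: hsep => //; rewrite mem_enum.
move=> [k Gk' [kz ky]]; exists (h \o (k \o h')).
  by apply: gen_comp => //; exact: gen_comp.
by split=> [|j]; rewrite !aut_act_comp ?kz ?ky aut_actK.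
Qed.

Lemma collective_transitivity s (x x' : 'I_s -> kpoint A) :
  (forall i j, i <> j -> x i <> x j) -> (forall i j, i <> j -> x' i <> x' j) ->
  (forall i, orbit_of G (x i) = orbit_of G (x' i)) ->
  (forall i, dim_ge (orbit_of G (x i)) 2) ->
  exists2 phi, G phi & forall i, aut_act phi (x i) = x' i.
Proof.
move=> xd x'd orb dimx.
suff H k : (k <= s)%N ->
    exists2 phi, G phi & forall i : 'I_s, (i < k)%N -> aut_act phi (x i) = x' i.
  by have [phi Gphi h] := H s (leqnn s); exists phi => // i; apply: h.
elim: k => [|k IHk] le_k.
  by exists idfun => //; exact: gen_id.
have [phi Gphi h] := IHk (ltnW le_k).
have [psi [Gpsi phiK psiK]] := replica_group_inv Gphi.
pose i0 := Ordinal le_k; pose w := widen_ord (ltnW le_k).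
have nw j : i0 <> w j by move=> /(congr1 val) /= E; have := ltn_ord j; rewrite -E ltnn.
have [||||g Gg [gx gy]] := @orbit_linked 'I_k (fun j => x' (w j)) (aut_act phi (x i0)) (x' i0).
- by rewrite orbit_of_act.
- rewrite orbit_of_act // orb; exists idfun; first exact: gen_id.
  exact/kpointP.
(* An element of the group is injective on points, so the moved point cannot meet a target already
   reached. *)
- move=> j; rewrite -(h (w j) (ltn_ord j)) => E; apply: (xd _ _ (nw j)).
  by rewrite -[LHS](aut_actK _ psiK) E aut_actK.
- by move=> j; apply: x'd.
exists (phi \o g); first exact: gen_comp.
move=> i; rewrite ltnS leq_eqVlt => /predU1P[ik|ik].
  by rewrite (_ : i = i0) ?aut_act_comp //; apply: val_inj.
rewrite aut_act_comp h //.
by have := gy (Ordinal ik); rewrite (_ : w _ = i) //; apply: val_inj.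
Qed.

End RootFlow.

Theorem theorem2
  (K : closedFieldType) (charK : [pchar K] =i pred0)
  (n : nat) (sigma : set 'rV[rat]_n)
  (sigma_poly : rational_polyhedral sigma)
  (sigma_convex : strongly_convex sigma)
  (X_nondeg : nondegenerate_variety (toric_algebra K sigma))
  (s : nat) (x x' : 'I_s -> kpoint (toric_algebra K sigma))
  (x_distinct : forall i j, i <> j -> x i <> x j)
  (x'_distinct : forall i j, i <> j -> x' i <> x' j)
  (same_orbit : forall i,
     orbit_of (replica_group K sigma) (x i) =
     orbit_of (replica_group K sigma) (x' i))
  (dim_orbit : forall i,
     dim_ge (orbit_of (replica_group K sigma) (x i)) 2) :
  exists2 phi, replica_group K sigma phi & forall i, aut_act phi (x i) = x' i.
Proof.
exact: (@collective_transitivity K n sigma charK sigma_poly sigma_convex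
  (toric_algebra K sigma) (@chi K n sigma) (@chi0 K n sigma) (@chiD K n sigma)
  (@chi_out K n sigma) (@toric_algebra_ind K n sigma)
  (fun e v => @root_derivation K n sigma e v)
  (fun e v m => @root_derivation_chi K n sigma e v m) s x x').
Qed.
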